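(* Let $\alpha>0$ be fixed and let $k=k_n$ be a sequence of positive integers with $k\to\infty$ and $k/n\to0$ as $n\to\infty$. Then $$\frac{M_{n,k}}{2\sqrt{k\log(n/k)}}\longrightarrow1\qquad\text{in probability as }n\to\infty.$$
   Context: For every $n$, $A=(A_{ij})_{1\le i,j\le n}$ is a real symmetric random matrix with $A_{ij}=A_{ji}\sim N(0,1)$ for $1\le i<j\le n$ and $A_{ii}\sim N(0,\alpha^2)$ for $1\le i\le n$, all random variables on and above the diagonal being independent. For $S\subset[n]=\{1,\dots,n\}$, $A_S$ is the principal submatrix indexed by $S$, and $$M_{n,k}:=\max_{\|x\|_0\le k,\ \|x\|_2=1}x^\top A x=\max_{S\subset[n],\,1\le|S|\le k}\lambda_{\max}(A_S),$$ where $\|x\|_0$ is the number of nonzero coordinates of $x\in\mathbb R^n$. *)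

(* Defs.v *)
From HB Require Import structures.
From mathcomp Require Import all_boot all_order all_algebra.
From mathcomp Require Import all_classical all_reals all_analysis.

Set Implicit Arguments.
Unset Strict Implicit.
Unset Printing Implicit Defensive.

Import Order.TTheory GRing.Theory Num.Theory.
Import numFieldNormedType.Exports.

Local Open Scope classical_set_scope.
Local Open Scope ring_scope.

(* Laws are compared on measurable sets only: the value of a measure on a
   non-measurable set carries no information. *)
Definition has_normal_law d (T : measurableType d) (R : realType)
    (P : probability T R) (X : {RV P >-> R}) (m s : R) : Prop :=
  forall U : set R, measurable U -> distribution P X U = normal_prob m s U.

Definition mutually_independent d (T : measurableType d) (R : realType)
    (P : probability T R) (I : finType) (D : {pred I})
    (X : I -> {RV P >-> R}) : Prop :=
  forall (J : {set I}) (U : I -> set R),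
    J \subset D -> (forall i, measurable (U i)) ->
    P (\bigcap_(i in [set` J]) (X i @^-1` U i)) =
    (\prod_(i in J) P (X i @^-1` U i))%E.

Definition gaussian_symmetric d (T : measurableType d) (R : realType)
    (P : probability T R) (n : nat) (alpha : R)
    (A : 'I_n -> 'I_n -> {RV P >-> R}) : Prop :=
  [/\ forall (i j : 'I_n) (t : T), A i j t = A j i t,
      forall i j : 'I_n, (i < j)%N -> has_normal_law (A i j) 0 1,
      forall i : 'I_n, has_normal_law (A i i) 0 alpha &
      mutually_independent [pred ij : 'I_n * 'I_n | (ij.1 <= ij.2)%N]
        (fun ij => A ij.1 ij.2)].

Definition l0norm (R : realType) (n : nat) (x : 'cV[R]_n) : nat :=
  #|[pred i : 'I_n | x i 0 != 0]|.

(* The library norm `|x| on matrices is the sup norm. *)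
Definition l2norm (R : realType) (n : nat) (x : 'cV[R]_n) : R :=
  Num.sqrt (\sum_(i < n) x i 0 ^+ 2).

(* For 0 < n and 0 < k the set is nonempty and compact, so the supremum is a
   maximum; when the set is empty (n = 0 or k = 0) the value is sup set0 = 0. *)
Definition sparse_max (R : realType) (n k : nat) (A : 'M[R]_n) : R :=
  sup [set (x^T *m A *m x) 0 0 | x in
        [set x : 'cV[R]_n | (l0norm x <= k)%N /\ l2norm x = 1]].

(* The spaces may vary with n, which is harmless for a constant limit. *)
Definition cvg_in_probability (R : realType) (d : nat -> measure_display)
    (T : forall n, measurableType (d n)) (P : forall n, probability (T n) R)
    (X : forall n, T n -> R) (l : R) : Prop :=
  forall eps : R, 0 < eps ->
    P n [set t | eps < `|X n t - l|] @[n --> \oo] --> 0%E.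

(* Main.v *)
Require Import Defs.
From HB Require Import structures.
From mathcomp Require Import all_boot all_order all_algebra.
From mathcomp Require Import all_classical all_reals all_analysis.
From mathcomp Require Import ring lra.

Import Order.TTheory GRing.Theory Num.Theory.
Import numFieldNormedType.Exports.
Import measurable_realfun.

(** Write L = log (n / k). The quadratic form splits into a diagonal part and an
    off-diagonal part. By a union bound all diagonal entries are at most
    delta sqrt (k L) with high probability (diagonal_large_prob), since k tends to
    infinity; so only the off-diagonal form matters, whose variance at a unit
    vector is at most 2.

    Upper bound. The k-sparse unit vectors are approximated by the k-sparse lattice
    vectors of norm at most 1 and mesh 1 / (r sqrt k) (net_approx), and the form on
    the sphere is at most 1 / (1 - 2 / r) times its maximum on this net
    (offdiag_form_net_bound). The net has at most expR (k L + C k) points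
    (card_net), where C depends on r only. At each point the absolute
    value of the form exceeds 2 (1 + delta) sqrt (k L) with probability at most
    2 expR (- (1 + delta) ^+ 2 k L), which wins as L tends to infinity
    (net_large_prob).

    Lower bound. Instead of a second moment argument, a good vector is constructed
    greedily. The vertices are examined one after the other. With S the set of
    vertices selected so far and x its weights, the vertex v is selected if the sum
    over i in S of x i * A i v is at least tau = (1 - delta) sqrt (2 L) standard
    deviations. This sum is independent of the earlier decisions, so each test
    succeeds with conditional probability at least q = expR (- tau ^+ 2 / 2 - o(L)),
    and n q is much larger than k; hence k vertices are found, except with
    probability expR (- k) (grow_small_prob). The selected vertex
    number r, counted from 0, gets the squared weight sqrt (r + 1) - sqrt r. Then
    each selection adds about sqrt 2 * tau to the form while the squared norm grows
    only to sqrt k, so that the normalized form is at least about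
    sqrt 2 * tau * sqrt k = 2 (1 - delta) sqrt (k L) (grow_invariant, sum_gain_ge).

    The independence used is that of events depending on disjoint groups of entries
    (mutually_independent_groups), and Gaussian sums enter only through their moment
    generating function (linear_sum_mgf), from which an upper tail bound follows by
    Chernoff's method and a lower one by tilting (gaussian_lower_tail). Finally the
    maximum is measurable, being determined by countably many integer vectors
    (sparse_max_gtP). *)

Set Implicit Arguments.
Unset Strict Implicit.
Unset Printing Implicit Defensive.

Local Open Scope classical_set_scope.
Local Open Scope ring_scope.

(** * Independence of disjoint groups of variables *)

Section independence.
Context d (T : measurableType d) (R : realType) (P : probability T R).
Context (I : finType) (X : I -> {RV P >-> R}).

(** The rectangles over J form a pi-system that generates the information
    carried by the variables of J. *)
Definition rectangles (J : {set I}) : set (set T) :=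
  [set B | exists2 U : I -> set R, (forall i, measurable (U i)) &
           B = \bigcap_(i in [set` J]) (X i @^-1` U i)].

(** The sample space with that sigma-algebra: a statement that a function is
    measurable on it says that the function depends on the variables of J only,
    and the usual measurability lemmas prove such statements. *)
Definition known_from (J : {set I}) := g_sigma_algebraType (rectangles J).

Lemma setI_closed_rectangles (J : {set I}) : setI_closed (rectangles J).
Proof.
move=> _ _ [U mU ->] [V mV ->]; exists (fun i => U i `&` V i).
  by move=> i; exact: measurableI.
by rewrite -bigcapI.
Qed.

Lemma rectangles_measurable (J : {set I}) B : rectangles J B -> measurable B.
Proof.
move=> [U mU ->]; apply: fin_bigcap_measurable => // i _.
by rewrite -[X in measurable X]setTI; exact: measurable_funP.
Qed.

Lemma known_measurable (J : {set I}) B :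
  <<s rectangles J >> B -> measurable B.
Proof.
apply: smallest_sub; first exact: sigma_algebra_measurable.
by move=> C; exact: rectangles_measurable.
Qed.

Lemma known_coord (J : {set I}) i : i \in J ->
  measurable_fun setT (X i : known_from J -> R).
Proof.
move=> iJ _ V mV; rewrite setTI; apply: sub_sigma_algebra.
exists (fun j => if j == i then V else setT).
  by move=> j; case: ifP.
apply/seteqP; split => t /=.
  by move=> Vt j _; case: eqP => [->|].
by move=> /(_ i iJ) /=; rewrite eqxx.
Qed.

Lemma known_mono (J K : {set I}) B : J \subset K ->
  <<s rectangles J >> B -> <<s rectangles K >> B.
Proof.
move=> JK; apply: smallest_sub; first exact: smallest_sigma_algebra.
move=> _ [U mU ->]; apply: sub_sigma_algebra.
exists (fun i => if i \in J then U i else setT) => [i|].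
  by case: ifP.
apply/seteqP; split => t /= tU i /= iK.
  by case: ifP => // iJ; exact: tU.
by have := tU i (fintype.subsetP JK _ iK); rewrite iK.
Qed.

Lemma rectanglesT (J : {set I}) : rectangles J setT.
Proof. by exists (fun=> setT) => //; rewrite bigcapT. Qed.

(** In the variable B both sides are finite measures of total mass P C, so that
    they agree on the sigma-algebra as soon as they agree on a pi-system
    generating it. *)
Lemma independence_extension (G : set (set T)) (C : set T) :
  setI_closed G -> G setT -> (forall B, G B -> measurable B) ->
  measurable C -> (forall B, G B -> P (B `&` C) = (P B * P C)%E) ->
  forall B, <<s G >> B -> P (B `&` C) = (P B * P C)%E.
Proof.
move=> GI GT Gm mC GP B GB.
have PCfin : P C \is a fin_num by exact: fin_num_measure.
have pC0 : 0 <= fine (P C) by rewrite fine_ge0.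
pose m1 : {measure set T -> \bar R} := mrestr P mC.
pose m2 : {measure set T -> \bar R} := mscale (NngNum pC0) P.
have -> : (P B * P C)%E = m2 B by rewrite /m2/= /mscale/= fineK// muleC.
have -> : P (B `&` C) = m1 B by [].
apply: (g_sigma_algebra_measure_unique G _ (fun=> setT)) => //.
- by rewrite bigcup_const.
- by move=> A GA; rewrite /m1 /m2/= /mrestr /mscale/= GP// fineK// muleC.
- move=> _; rewrite /m1/= /mrestr setTI.
  by rewrite ltey_eq PCfin.
Qed.

(** Two rectangles over disjoint index sets meet in a rectangle over the union,
    where independence is the hypothesis; the extension lemma is then applied to
    one event at a time. *)
Lemma mutually_independent_groups (D : {pred I}) (J K : {set I}) B C :
  mutually_independent D X -> J \subset D -> K \subset D -> {in J, forall i, i \notin K} ->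
  <<s rectangles J >> B -> <<s rectangles K >> C ->
  P (B `&` C) = (P B * P C)%E.
Proof.
move=> indep JD KD dJK JB KC.
apply: (independence_extension (@setI_closed_rectangles J)) JB.
- exact: rectanglesT.
- by move=> ?; exact: rectangles_measurable.
- exact: known_measurable KC.
move=> {}B [U mU BE].
rewrite setIC muleC.
apply: (independence_extension (@setI_closed_rectangles K)) KC.
- exact: rectanglesT.
- by move=> ?; exact: rectangles_measurable.
- by apply: (@rectangles_measurable J); exists U.
move=> {}C [V mV CE].
pose W i := if i \in J then U i else V i.
have BCE : C `&` B = \bigcap_(i in [set` J :|: K]) (X i @^-1` W i).
  apply/seteqP; rewrite BE CE; split => t /=.
    move=> [tV tU] i /=; rewrite inE /W.
    case: ifP => [iJ _|_ /= iK]; first exact: tU.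
    exact: tV.
  move=> tW; split=> i /= iJ.
    have := tW i; rewrite /= inE iJ orbT /W => /(_ isT).
    case: ifP => // iJ'.
    by have := dJK _ iJ'; rewrite iJ.
  by have := tW i; rewrite /= inE [i \in J]iJ /W iJ /=; apply.
rewrite BCE indep; last 2 first.
- apply/fintype.subsetP => i; rewrite inE => /orP[]; exact: fintype.subsetP.

- by move=> i; rewrite /W; case: ifP.
rewrite (bigID (mem J))/=.
rewrite (eq_bigl [in J]); last first.
  by move=> i /=; rewrite inE andbC andb_orr andbb; case: (i \in J).
rewrite [X in (_ * X)%E = _](eq_bigl [in K]); last first.
  move=> i /=; rewrite inE; case: (boolP (i \in J)) => //= [/dJK/negbTE ->//|_].
  by rewrite andbT.
rewrite BE CE !indep// [RHS]muleC; congr (_ * _)%E; apply: eq_bigr => i iJ.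
  by rewrite /W iJ.
rewrite /W ifF//; apply/negP => iJ'.
by have := dJK _ iJ'; rewrite [i \in K]iJ.
Qed.

End independence.

(** * Integrals of Gaussian and of independent variables *)

(** Completing the square: exponential tilting of a centred normal density gives
    a constant times a shifted normal density. *)
Lemma normal_exponent_shift (F : numFieldType) (l s x : F) : s != 0 ->
  l * x + - (x - 0) ^+ 2 / (s ^+ 2 *+ 2) =
  l ^+ 2 * s ^+ 2 / 2 + - (x - l * s ^+ 2) ^+ 2 / (s ^+ 2 *+ 2).
Proof. by move=> s0; rewrite -mulr_natr; field. Qed.

Section gaussian_integrals.
Context (R : realType).
Local Notation mu := (@lebesgue_measure R).

(** The Radon-Nikodym derivative of the normal law is almost everywhere its
    density, because both have the same integral over every measurable set. *)
Lemma ge0_integral_normal_prob (m s : R) (f : R -> \bar R) :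
  measurable_fun setT f -> (forall x, 0 <= f x)%E ->
  (\int[normal_prob m s]_x f x = \int[mu]_x (f x * (normal_pdf m s x)%:E))%E.
Proof.
move=> mf f0.
have dom := @normal_prob_dominates R m s.
pose nu : {finite_measure set _ -> \bar R} := normal_prob m s.
have mpdf : measurable_fun setT (fun x => (normal_pdf m s x)%:E).
  by apply/measurable_EFinP; exact: measurable_normal_pdf.
have iRN := @Radon_Nikodym_SigmaFinite.f_integrable _ _ _ nu mu dom.
rewrite -(@Radon_Nikodym_SigmaFinite.change_of_variables _ _ _ nu mu)//.
apply: ae_eq_integral => //.
- by apply: emeasurable_funM => //; exact: (measurable_int mu).
- exact: emeasurable_funM.
- apply: ae_eqe_mul2l; apply: integral_ae_eq => //= E _ mE.
  by rewrite -Radon_Nikodym_SigmaFinite.f_integral.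
Qed.

Lemma normal_prob_mgf (s l : R) : s != 0 ->
  (\int[normal_prob 0 s]_x (expR (l * x))%:E =
   (expR (l ^+ 2 * s ^+ 2 / 2))%:E)%E.
Proof.
move=> s0; rewrite ge0_integral_normal_prob; last 2 first.
- apply/measurable_EFinP; apply: measurableT_comp => //.
- by move=> x; rewrite lee_fin expR_ge0.
under eq_integral => x _.
  have -> : ((expR (l * x))%:E * (normal_pdf 0 s x)%:E =
    (expR (l ^+ 2 * s ^+ 2 / 2))%:E * (normal_pdf (l * s ^+ 2) s x)%:E)%E.
    rewrite -!EFinM !normal_pdfE// mulrCA [in RHS]mulrCA -!expRD.
    by rewrite normal_exponent_shift.
  over.
rewrite ge0_integralZl_EFin ?expR_ge0//.
- by rewrite integral_normal_pdf mule1.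
- by move=> x _; rewrite lee_fin normal_pdf_ge0.
- by apply/measurable_EFinP; exact: measurable_normal_pdf.
Qed.

End gaussian_integrals.

Section moment_generating.
Context d (T : measurableType d) (R : realType) (P : probability T R).

Lemma normal_law_mgf (X : {RV P >-> R}) (s l : R) : s != 0 ->
  has_normal_law X 0 s ->
  (\int[P]_t (expR (l * X t))%:E = (expR (l ^+ 2 * s ^+ 2 / 2))%:E)%E.
Proof.
move=> s0 lawX; rewrite -normal_prob_mgf//.
pose X' : {mfun T >-> measurableTypeR R} :=
  HB.pack (X : T -> measurableTypeR R)
    (@isMeasurableFun.Build _ _ T (measurableTypeR R) X (measurable_funPT X)).
transitivity (\int[distribution P X']_x (expR (l * x))%:E)%E; last first.
  by apply: eq_measure_integral => A mA _; exact: lawX.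
rewrite /distribution ge0_integral_pushforward//.
by apply/measurable_EFinP; apply: measurableT_comp.
Qed.

(** The law of the pair (U, V) and the product of the two laws agree on products
    of measurable sets, hence are equal, and Tonelli's theorem applies. *)
Lemma integralM_independent (U V : T -> R) :
  measurable_fun setT U -> measurable_fun setT V ->
  (forall t, 0 <= U t) -> (forall t, 0 <= V t) ->
  (forall A B : set R, measurable A -> measurable B ->
     P (U @^-1` A `&` V @^-1` B) = (P (U @^-1` A) * P (V @^-1` B))%E) ->
  (\int[P]_t (U t * V t)%:E = \int[P]_t (U t)%:E * \int[P]_t (V t)%:E)%E.
Proof.
move=> mU mV U0 V0 indep.
pose W : {mfun T >-> (R * R)%type} := HB.pack (fun t => (U t, V t))
  (@isMeasurableFun.Build _ _ _ _ (fun t => (U t, V t)) (measurable_fun_pair mU mV)).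
pose mU' : {mfun T >-> R} := HB.pack U (@isMeasurableFun.Build _ _ _ _ U mU).
pose mV' : {mfun T >-> R} := HB.pack V (@isMeasurableFun.Build _ _ _ _ V mV).
(* The absolute values make f nonnegative off the range of (U, V). *)
pose f (p : R * R) : \bar R := (`|p.1| * `|p.2|)%:E.
have mf : measurable_fun setT f.
  apply/measurable_EFinP; apply: measurable_funM; exact: measurableT_comp.
have f0 p : (0 <= f p)%E by rewrite lee_fin mulr_ge0.
transitivity (\int[distribution P W]_p f p)%E.
  rewrite /distribution ge0_integral_pushforward//.
  by apply: eq_integral => t _ /=; rewrite /f/= !ger0_norm.
transitivity (\int[distribution P mU' \x distribution P mV']_p f p)%E.
  apply: eq_measure_integral => A mA _; apply/esym.
  exact: product_measure_unique.
have mabs : measurable_fun setT (fun x : R => `|x|%:E).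
  by apply/measurable_EFinP; exact: normr_measurable.
rewrite fubini_tonelli1// /fubini_F /f/=.
under eq_integral => x _.
  under eq_integral do rewrite EFinM.
  rewrite ge0_integralZl_EFin//.
  rewrite muleC; over.
rewrite ge0_integralZl//; last exact: integral_ge0.
rewrite muleC; congr (_ * _)%E; rewrite ge0_integral_pushforward//=;
  by apply: eq_integral => t _ /=; rewrite ger0_norm.
Qed.

(** Markov's inequality in the form that serves for all tail bounds below. *)
Lemma prob_le_integral (A : set T) (g : T -> R) :
  measurable A -> measurable_fun setT g -> (forall t, 0 <= g t) ->
  (forall t, A t -> 1 <= g t) -> (P A <= \int[P]_t (g t)%:E)%E.
Proof.
move=> mA mg g0 g1; rewrite -[A]setIT -integral_indic//.
apply: ge0_le_integral => //.

- by apply/measurable_EFinP; exact: measurable_indic.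
- exact/measurable_EFinP.
- move=> t _; rewrite lee_fin indicE; case: (boolP (t \in A)) => //.
  by rewrite inE => /g1.
Qed.

End moment_generating.

(** * Gaussian tails from the moment generating function *)

Lemma expR2_ge4 (R : realType) : 4 <= expR 2 :> R.
Proof.
have -> : 2 = 1 + 1 :> R by [].
rewrite expRD; have := expR_ge1Dx (1 : R); nra.
Qed.

Lemma ge0_integralD3 d (T : measurableType d) (R : realType)
    (mu : {measure set T -> \bar R}) (f g h : T -> \bar R) :
  measurable_fun setT f -> measurable_fun setT g -> measurable_fun setT h ->
  (forall t, 0 <= f t)%E -> (forall t, 0 <= g t)%E -> (forall t, 0 <= h t)%E ->
  (\int[mu]_t (f t + g t + h t) =
   \int[mu]_t f t + \int[mu]_t g t + \int[mu]_t h t)%E.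
Proof.
move=> mf mg mh f0 g0 h0.
rewrite ge0_integralD//; first by rewrite ge0_integralD.
- by move=> t _; exact: adde_ge0.
- exact: emeasurable_funD.
Qed.

Section gaussian_tails.
Context d (T : measurableType d) (R : realType) (P : probability T R).

(** The moment generating function of N(0, v). All estimates below use nothing
    else about Gaussian variables, so that the law of a sum of independent ones
    never has to be computed. *)
Definition gaussian_mgf (Y : T -> R) (v : R) :=
  forall l : R, (\int[P]_t (expR (l * Y t))%:E = (expR (l ^+ 2 * v / 2))%:E)%E.

Lemma measurable_expR_scale (Y : T -> R) (l : R) :
  measurable_fun setT Y -> measurable_fun setT (fun t => expR (l * Y t)).
Proof. by move=> mY; apply: measurableT_comp => //; apply: measurable_funM. Qed.

Lemma measurable_ge (Y : T -> R) (a : R) :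
  measurable_fun setT Y -> measurable [set t | a <= Y t].
Proof.
move=> mY; rewrite -[X in measurable X]setTI.
have -> : [set t | a <= Y t] = Y @^-1` `[a, +oo[.
  by apply/seteqP; split => t /=; rewrite in_itv/= andbT.
exact: mY.
Qed.

Lemma measurable_abs_ge (Y : T -> R) (a : R) :
  measurable_fun setT Y -> measurable [set t | a <= `|Y t|].
Proof. by move=> mY; apply: measurable_ge; exact: measurableT_comp. Qed.

(** Tilting: under the probability with density proportional to expR (l * Y),
    where l = a + 2, the variable Y is centred at l, and two Chernoff bounds show
    that it lies between a and a + 4 with probability at least 1 - 2 / e^2. There
    expR (l * Y) is at most expR (l * (a + 4)), which turns this into a lower bound
    for the original probability. Its defect against expR (- a ^+ 2 / 2) is only
    exponential in a, negligible for large a. *)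
Lemma gaussian_lower_tail (Y : T -> R) (a : R) :
  measurable_fun setT Y -> gaussian_mgf Y 1 -> 0 <= a ->
  ((expR (- (a ^+ 2 / 2 + 4 * a + 6)) / 2)%:E <= P [set t | (a <= Y t)%R])%E.
Proof.
move=> mY mgfY a0.
have mA := measurable_ge a mY; set A := [set t | a <= Y t] in mA *.
pose l := a + 2.
pose c1 := expR (l * (a + 4)); pose c2 := expR (2 * a); pose c3 := expR (- 2 * (a + 4)).
(* One term suffices in each case: Y t < a, a <= Y t <= a + 4 and a + 4 < Y t. *)
have pointwise t : expR (l * Y t) <=
    c1 * \1_A t + c2 * expR ((l - 2) * Y t) + c3 * expR ((l + 2) * Y t).
  rewrite /c1 /c2 /c3 indicE -!expRD.
  have [Ya|aY] := ltP (Y t) a.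
    rewrite -[leLHS]add0r -[leLHS]addr0; apply: lerD; last exact: expR_ge0.
    apply: lerD; first by rewrite mulr_ge0 ?expR_ge0.
    by rewrite ler_expR; nra.
  rewrite mem_set//= mulr1.
  have [Ya4|aY4] := leP (Y t) (a + 4).
    rewrite -[leLHS]addr0; apply: lerD; last exact: expR_ge0.
    rewrite -[leLHS]addr0; apply: lerD; last exact: expR_ge0.
    by rewrite ler_expR /l; nra.
  rewrite -[leLHS]add0r; apply: lerD; first by rewrite addr_ge0 ?expR_ge0.
  by rewrite ler_expR /l; nra.
have m1 : measurable_fun setT (fun t => (c1 * \1_A t)%:E).
  by apply/measurable_EFinP; apply: measurable_funM => //; exact: measurable_indic.
have mexp c s : measurable_fun setT (fun t => (c * expR (s * Y t))%:E).
  by apply/measurable_EFinP; apply: measurable_funM => //; exact: measurable_expR_scale.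
have : ((expR (l ^+ 2 * 1 / 2))%:E <= c1%:E * P A +
    (c2 * expR ((l - 2) ^+ 2 * 1 / 2))%:E + (c3 * expR ((l + 2) ^+ 2 * 1 / 2))%:E)%E.
  rewrite (EFinM c2) (EFinM c3) -(mgfY l) -(mgfY (l - 2)) -(mgfY (l + 2)).
  have -> : P A = (\int[P]_t (\1_A t)%:E)%E by rewrite integral_indic// setIT.
  rewrite -!ge0_integralZl_EFin ?expR_ge0//; last 3 first.
  - by apply/measurable_EFinP; exact: measurable_expR_scale.
  - by apply/measurable_EFinP; exact: measurable_expR_scale.
  - by apply/measurable_EFinP; exact: measurable_indic.
  rewrite -(ge0_integralD3 P m1 (mexp c2 (l - 2)) (mexp c3 (l + 2))) //; first last.
  - by move=> t; rewrite lee_fin mulr_ge0 ?expR_ge0.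
  - by move=> t; rewrite lee_fin mulr_ge0 ?expR_ge0.
  - by move=> t; rewrite lee_fin mulr_ge0 ?expR_ge0.
  apply: ge0_le_integral => //.
  - by apply/measurable_EFinP; exact: measurable_expR_scale.
  - apply: emeasurable_funD; last exact: mexp.
    by apply: emeasurable_funD; [exact: m1|exact: mexp].
  - by move=> t _; rewrite -!EFinD lee_fin; exact: pointwise.
rewrite -[P A]fineK; last exact: fin_num_measure.
rewrite -EFinM -!EFinD !lee_fin; set p := fine _.
have E2 : c2 * expR ((l - 2) ^+ 2 * 1 / 2) = expR (l ^+ 2 * 1 / 2) * (expR 2)^-1.
  by rewrite /c2 -expRN -!expRD; congr expR; rewrite /l; lra.
have E3 : c3 * expR ((l + 2) ^+ 2 * 1 / 2) = expR (l ^+ 2 * 1 / 2) * (expR 2)^-1.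
  by rewrite /c3 -expRN -!expRD; congr expR; rewrite /l; lra.
rewrite E2 E3.
have -> : expR (- (a ^+ 2 / 2 + 4 * a + 6)) = expR (l ^+ 2 * 1 / 2) / c1.
  by rewrite /c1 -expRN -expRD; congr expR; rewrite /l; lra.
have e2 : (expR 2)^-1 <= 4^-1 :> R by rewrite lef_pV2 ?posrE ?expR_gt0 ?expR2_ge4.
have g0 : 0 < expR (l ^+ 2 * 1 / 2) by exact: expR_gt0.
set g := expR _ in g0 *; move: e2; set e := (expR 2)^-1 => e2 H.
rewrite mulrAC ler_pdivrMr ?expR_gt0// mulrC.
by nra.
Qed.

End gaussian_tails.

(** * Sums of independent Gaussian variables *)

Section gaussian_sums.
Context d (T : measurableType d) (R : realType) (P : probability T R).
Context (I : finType) (X : I -> {RV P >-> R}) (D : {pred I}).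
Hypothesis indep : mutually_independent D X.

Definition linear_sum (J : {set I}) (c : I -> R) (t : T) : R :=
  \sum_(i in J) c i * X i t.

Lemma known_linear_sum (J : {set I}) (c : I -> R) :
  measurable_fun setT (linear_sum J c : known_from X J -> R).
Proof.
rewrite /linear_sum; under eq_fun do rewrite big_mkcond.
apply: measurable_sum => i; case: (boolP (i \in J)) => iJ; last exact: measurable_cst.
apply: (@measurable_funM _ (known_from X J) R setT (cst (c i)) (X i)).
  exact: measurable_cst.
exact: known_coord.
Qed.

Lemma measurable_linear_sum (J : {set I}) (c : I -> R) :
  measurable_fun setT (linear_sum J c).
Proof.
rewrite /linear_sum; under eq_fun do rewrite big_mkcond.
apply: measurable_sum => i; case: (i \in J); last exact: measurable_cst.
exact: measurable_funM.
Qed.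

Lemma known_preimage (J : {set I}) (f : T -> R) (B : set R) :
  measurable_fun setT (f : known_from X J -> R) -> measurable B ->
  <<s rectangles X J >> (f @^-1` B).
Proof. by move=> mf mB; have := mf measurableT B mB; rewrite setTI. Qed.

(** Splitting off one index i, the exponential of the sum is a product of two
    factors known from disjoint sets of variables, hence independent. *)
Lemma linear_sum_mgf (J : {set I}) (c : I -> R) :
  J \subset D -> {in J, forall i, has_normal_law (X i) 0 1} ->
  gaussian_mgf P (linear_sum J c) (\sum_(i in J) c i ^+ 2).
Proof.
move=> JD law l; elim: {J}_.+1 {-2}J (ltnSn #|J|) JD law => // m IH J cardJ JD law.
have [->|[i iJ]] := finset.set_0Vmem J.
  rewrite big_set0 mulr0 mul0r /linear_sum.
  under eq_integral do rewrite big_set0 mulr0.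
  rewrite expR0 integral_cst// mul1e; exact: probability_setT.
pose K := J :\ i.
have iK : i \notin K by rewrite !inE eqxx.
have KJ : K \subset J by exact: finset.subsetDl.
have JE : J = i |: K by rewrite finset.setD1K.
rewrite JE big_setU1//= /linear_sum.
under eq_integral => t _.
  rewrite big_setU1//= mulrDr expRD -/(linear_sum K c t).
  over.
rewrite (@integralM_independent _ _ _ _ (fun t => expR (l * (c i * X i t)))
  (fun t => expR (l * linear_sum K c t))); last 5 first.
- by apply: measurable_expR_scale; exact: measurable_funM.
- by apply: measurable_expR_scale; exact: measurable_linear_sum.
- by move=> t; exact: expR_ge0.
- by move=> t; exact: expR_ge0.
- move=> A B mA mB.
  apply: (mutually_independent_groups (J := [set i]%SET) (K := K) indep).
  + by apply/fintype.subsetP => j; rewrite inE => /eqP ->; exact: (fintype.subsetP JD).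
  + exact: fintype.subset_trans JD.
  + by move=> j; rewrite inE => /eqP ->.
  + apply: (known_preimage (J := [set i]%SET)) => //.
    apply: measurable_expR_scale; apply: measurable_funM => //.
    by apply: known_coord; rewrite inE.
  + apply: (known_preimage (J := K)) => //.
    by apply: measurable_expR_scale; exact: known_linear_sum.
rewrite IH; last 3 first.
- by move: cardJ; rewrite (finset.cardsD1 i) iJ.
- exact: fintype.subset_trans JD.
- by move=> j jK; apply: law; exact: (fintype.subsetP KJ).
under eq_integral do rewrite mulrA.
rewrite (normal_law_mgf _ (oner_neq0 R)); last exact: law.
rewrite -EFinM -expRD; congr (expR _)%:E; ring.
Qed.

End gaussian_sums.

(** * Off-diagonal quadratic forms *)

Section quadratic_forms.
Context (R : realType) (n : nat).
Implicit Types (A : 'I_n -> 'I_n -> R) (x y u v : 'I_n -> R).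

Definition pairs : {set 'I_n * 'I_n} := [set p : 'I_n * 'I_n | (p.1 < p.2)%N]%SET.

(** The quadratic form without its diagonal part. The diagonal of a large Gaussian
    matrix is negligible on sparse vectors, and without it the variance of the
    form at a unit vector is at most 2 whatever alpha is. *)
Definition offdiag_form A x : R :=
  \sum_(p in pairs) 2 * (x p.1 * x p.2) * A p.1 p.2.

Definition sqnorm x : R := \sum_i x i ^+ 2.

Definition sparsity x : nat := #|[pred i | x i != 0]|.

Lemma form_split A x : (forall i j, A i j = A j i) ->
  \sum_i \sum_j x i * A i j * x j =
  \sum_i A i i * x i ^+ 2 + offdiag_form A x.
Proof.
move=> symA; rewrite pair_bigA/=.
rewrite (bigID (fun p : 'I_n * 'I_n => p.1 == p.2))/=; congr (_ + _).
  rewrite (reindex_onto (fun i : 'I_n => (i, i)) fst)/=; last first.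
    by move=> [i j] /= /eqP ->.
  apply: eq_big => [i|i _]; first by rewrite !eqxx.
  by rewrite mulrAC -expr2 mulrC.
rewrite (bigID (fun p : 'I_n * 'I_n => (p.1 < p.2)%N))/=.
rewrite [X in _ + X](reindex_inj (h := fun p : 'I_n * 'I_n => (p.2, p.1)))/=; last first.
  by move=> [a b] [c e] [-> ->].
rewrite [X in _ + X](eq_bigl (fun p : 'I_n * 'I_n => (p.1 != p.2) && (p.1 < p.2)%N)).
  rewrite -big_split/=; apply: eq_big => [p|p _].
    by rewrite inE andb_idl// neq_ltn => ->.
  rewrite (symA p.2); ring.
move=> p /=; rewrite eq_sym; case: eqVneq => //= ne.
by rewrite -leqNgt leq_eqVlt val_eqE (negbTE ne).
Qed.

(** Expanding the square of the sum of the x i ^+ 2 gives every pair twice, plus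
    nonnegative diagonal terms. *)
Lemma offdiag_variance_le x :
  \sum_(p in pairs) (2 * (x p.1 * x p.2)) ^+ 2 <= 2 * sqnorm x ^+ 2.
Proof.
have := @form_split (fun _ _ => 1) (fun i => x i ^+ 2) (fun _ _ => erefl).
rewrite /sqnorm expr2 big_distrlr/= /offdiag_form.
under eq_bigr do under eq_bigr do rewrite mulr1.
move=> ->; rewrite mulrDr -[leLHS]add0r; apply: lerD.
  by rewrite mulr_ge0// sumr_ge0// => i _; rewrite mul1r sqr_ge0.
rewrite mulr_sumr le_eqVlt; apply/orP; left; apply/eqP; apply: eq_bigr => p _; ring.
Qed.

(** The difference of a quadratic form at x and y is the associated bilinear form
    at (x - y, x + y), here expressed by the form itself; the free parameter s
    balances a short x - y against a long x + y. *)
Lemma offdiag_form_polarization A x y (s : R) : s != 0 ->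
  offdiag_form A x - offdiag_form A y =
  (offdiag_form A (fun i => s * (x i - y i) + (x i + y i) / s) -
   offdiag_form A (fun i => s * (x i - y i) - (x i + y i) / s)) / 4.
Proof.
move=> s0; rewrite /offdiag_form -!sumrB mulr_suml; apply: eq_bigr => p _.
by field.
Qed.

Lemma offdiag_formZ A x (a : R) :
  offdiag_form A (fun i => a * x i) = a ^+ 2 * offdiag_form A x.
Proof. by rewrite /offdiag_form mulr_sumr; apply: eq_bigr => p _; ring. Qed.

Lemma sqnorm_ge0 x : 0 <= sqnorm x.
Proof. by apply: sumr_ge0 => i _; exact: sqr_ge0. Qed.

Lemma sqnormZ x (a : R) : sqnorm (fun i => a * x i) = a ^+ 2 * sqnorm x.
Proof. by rewrite /sqnorm mulr_sumr; apply: eq_bigr => p _; ring. Qed.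

Lemma coord_le_sqnorm x i : x i ^+ 2 <= sqnorm x.
Proof.
by rewrite /sqnorm (bigD1 i)//= lerDl sumr_ge0// => j _; exact: sqr_ge0.
Qed.

Lemma sqnorm_eq0 x : sqnorm x = 0 -> forall i, x i = 0.
Proof.
move=> x0 i; apply/eqP; rewrite -sqrf_eq0 eq_le sqr_ge0 andbT -x0.
exact: coord_le_sqnorm.
Qed.

Lemma sparsity_le x y : (forall i, x i = 0 -> y i = 0) ->
  (sparsity y <= sparsity x)%N.
Proof.
move=> xy; apply: subset_leq_card; apply/fintype.subsetP => i; rewrite !inE.
by apply: contra_neq; exact: xy.
Qed.

Lemma offdiag_form_le A x : sqnorm x = 1 ->
  `|offdiag_form A x| <= \sum_(p in pairs) 2 * `|A p.1 p.2|.
Proof.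
move=> x1; apply: (le_trans (ler_norm_sum _ _ _)); apply: ler_sum => p _.
have x_le1 i : `|x i| <= 1.
  by rewrite -ler_sqr ?nnegrE// expr1n real_normK ?num_real// -x1 coord_le_sqnorm.
rewrite !normrM ger0_norm// -mulrA; apply: ler_wpM2l => //.
apply: ler_piMl => //; exact: mulr_ile1.
Qed.

Lemma offdiag_form_homogeneous_le A (k : nat) (Q : R) :
  (forall x, (sparsity x <= k)%N -> sqnorm x = 1 -> `|offdiag_form A x| <= Q) ->
  forall w, (sparsity w <= k)%N -> `|offdiag_form A w| <= Q * sqnorm w.
Proof.
move=> HQ w wk; have [w0|w0] := eqVneq (sqnorm w) 0.
  rewrite w0 mulr0 /offdiag_form big1 ?normr0// => p _.
  by rewrite (sqnorm_eq0 w0) mul0r mulr0 mul0r.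
have wpos : 0 < sqnorm w by rewrite lt_def w0 sqnorm_ge0.
pose a := (Num.sqrt (sqnorm w))^-1.
have a2 : a ^+ 2 = (sqnorm w)^-1 by rewrite exprVn sqr_sqrtr ?sqnorm_ge0.
have := HQ (fun i => a * w i); rewrite offdiag_formZ sqnormZ a2 mulVf//.
move=> /(_ _ erefl); rewrite normrM ger0_norm ?invr_ge0 ?sqnorm_ge0//.
rewrite mulrC ler_pdivrMr//; apply.
by apply: leq_trans wk; apply: sparsity_le => i ->; rewrite mulr0.
Qed.

(** With s ^+ 2 = 2 * r the two vectors of the polarization identity have squared
    norms of sum at most 8 / r. *)
Lemma offdiag_form_perturb A (k : nat) (Q r : R) x y : 0 < r -> 0 <= Q ->
  (forall w, (sparsity w <= k)%N -> `|offdiag_form A w| <= Q * sqnorm w) ->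
  (sparsity x <= k)%N -> (forall i, x i = 0 -> y i = 0) ->
  sqnorm (fun i => x i - y i) <= (r ^+ 2)^-1 ->
  sqnorm (fun i => x i + y i) <= 4 ->
  `|offdiag_form A x - offdiag_form A y| <= 2 / r * Q.
Proof.
move=> r0 Q0 HQ xk xy dxy sxy.
have s0 : 0 < Num.sqrt (2 * r) by rewrite sqrtr_gt0 mulr_gt0.
set s := Num.sqrt _ in s0.
have s2 : s ^+ 2 = 2 * r by rewrite sqr_sqrtr// mulr_ge0// ltW.
rewrite (offdiag_form_polarization A x y (lt0r_neq0 s0)).
set w1 := fun i => _ + _; set w2 := fun i => _ - _.
have w1k : (sparsity w1 <= k)%N.
  apply: leq_trans xk; apply: sparsity_le => i xi0.
  by rewrite /w1 (xy _ xi0) xi0 subrr addr0 mul0r mulr0 addr0.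
have w2k : (sparsity w2 <= k)%N.
  apply: leq_trans xk; apply: sparsity_le => i xi0.
  by rewrite /w2 (xy _ xi0) xi0 subrr addr0 mul0r mulr0 subr0.
have parallelogram : sqnorm w1 + sqnorm w2 = 2 * s ^+ 2 * sqnorm (fun i => x i - y i) +
    2 / s ^+ 2 * sqnorm (fun i => x i + y i).
  rewrite /sqnorm !mulr_sumr -!big_split/=; apply: eq_bigr => i _.
  by rewrite /w1 /w2; field; exact: lt0r_neq0.
have bound : sqnorm w1 + sqnorm w2 <= 8 / r.
  rewrite parallelogram s2.
  have -> : 8 / r = 2 * (2 * r) * (r ^+ 2)^-1 + 2 / (2 * r) * 4.
    by field; exact: lt0r_neq0.
  apply: lerD; apply: ler_wpM2l => //; first by rewrite !mulr_ge0// ltW.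
  by rewrite divr_ge0// mulr_ge0// ltW.
rewrite normrM (@ger0_norm _ 4^-1)// ler_pdivrMr//.
apply: le_trans (ler_normB _ _) _.
apply: le_trans (lerD (HQ _ w1k) (HQ _ w2k)) _.
rewrite -mulrDr (le_trans (ler_wpM2l Q0 bound))// le_eqVlt; apply/orP; left.
by apply/eqP; ring.
Qed.

End quadratic_forms.

(** * A lattice net of sparse vectors *)

Section net.
Context (R : realType) (n N : nat).
Implicit Types (A : 'I_n -> 'I_n -> R) (x y : 'I_n -> R).

(** A coordinate of a net vector: absolute value and sign, in lattice units. *)
Definition code := ('I_N.+1 * bool)%type.

Definition code_val (c : code) : R := (-1) ^+ c.2 * (c.1 : nat)%:R.

(** Net vectors are the k-sparse vectors of norm at most 1 in the lattice of mesh
    1 / (r sqrt k). The last condition leaves a single code for the coordinate 0;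
    this matters for counting, as most coordinates are 0. *)
Definition in_net (k r : nat) (z : {ffun 'I_n -> code}) : bool :=
  [&& (#|[pred i | (z i).1 != ord0]| <= k)%N,
      (\sum_i (z i).1 ^ 2 <= r ^ 2 * k)%N &
      [forall i, ((z i).1 == ord0) ==> ~~ (z i).2]].

Definition net_point (k r : nat) (z : {ffun 'I_n -> code}) (i : 'I_n) : R :=
  code_val (z i) / (r%:R * Num.sqrt k%:R).

Lemma code_val_sqr (c : code) : code_val c ^+ 2 = (c.1 ^ 2)%:R.
Proof. by rewrite /code_val exprMn sqrr_sign mul1r natrX. Qed.

Lemma net_point_sqnorm (k r : nat) z : (0 < k)%N -> (0 < r)%N ->
  in_net k r z -> sqnorm (net_point k r z) <= 1.
Proof.
move=> k0 r0 /and3P[_ zr _]; rewrite /sqnorm /net_point.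
under eq_bigr => i _ do rewrite exprMn code_val_sqr exprVn exprMn sqr_sqrtr ?ler0n//.
rewrite -mulr_suml ler_pdivrMr ?mulr_gt0 ?exprn_gt0 ?ltr0n// mul1r.
by rewrite -natr_sum -natrX -natrM ler_nat.
Qed.

(** Rounding towards 0 moves a coordinate by at most the mesh without increasing
    it in absolute value. *)
Lemma rounding (rho a : R) (m : nat) : 0 < rho -> m = Num.truncn (`|a| * rho) ->
  let b := (-1) ^+ (a < 0)%R * m%:R / rho in
  [/\ (a - b) ^+ 2 <= (rho ^+ 2)^-1, b ^+ 2 <= a ^+ 2, (a + b) ^+ 2 <= 4 * a ^+ 2 &
      m%:R <= `|a| * rho].
Proof.
move=> rho0 mE b.
have /andP[lo hi] : m%:R <= `|a| * rho < m.+1%:R.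
  by rewrite mE; apply: truncn_itv; rewrite mulr_ge0// ltW.
rewrite -natr1 in hi.
have bE : b = (-1) ^+ (a < 0)%R * (m%:R / rho) by rewrite /b mulrA.
have aE : a = (-1) ^+ (a < 0)%R * `|a|.
  have [a0|a0] := ltrP a 0; first by rewrite ltr0_norm// expr1 mulN1r opprK.
  by rewrite ger0_norm// expr0 mul1r.
have b0 : 0 <= m%:R / rho by rewrite divr_ge0 ?ler0n// ltW.
have ba : m%:R / rho <= `|a| by rewrite ler_pdivrMr.
have ab : `|a| - m%:R / rho <= rho^-1.
  by rewrite -(ler_pM2r rho0) mulrBl mulfVK ?mulVf ?lt0r_neq0// lerBlDr addrC ltW.
have E1 : (a - b) ^+ 2 = (`|a| - m%:R / rho) ^+ 2.
  by rewrite bE {1}aE -mulrBr exprMn sqrr_sign mul1r.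
have E2 : b ^+ 2 = (m%:R / rho) ^+ 2 by rewrite bE exprMn sqrr_sign mul1r.
have E3 : (a + b) ^+ 2 = (`|a| + m%:R / rho) ^+ 2.
  by rewrite bE {1}aE -mulrDr exprMn sqrr_sign mul1r.
have E4 : a ^+ 2 = `|a| ^+ 2 by rewrite real_normK ?num_real.
have rV : 0 < rho^-1 by rewrite invr_gt0.
rewrite E1 E2 E3 E4 -exprVn; split=> //; nra.
Qed.

(** Rounding towards 0 keeps the support, so that at most k coordinates move and
    the squared error is at most k times the squared mesh, which is r ^- 2. *)
Lemma net_approx (k r : nat) x : (0 < k)%N -> (0 < r)%N -> N = (r * k)%N ->
  (sparsity x <= k)%N -> sqnorm x = 1 ->
  exists2 z, in_net k r z &
    [/\ forall i, x i = 0 -> net_point k r z i = 0,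
        sqnorm (fun i => x i - net_point k r z i) <= (r%:R ^+ 2)^-1 &
        sqnorm (fun i => x i + net_point k r z i) <= 4].
Proof.
move=> k0 r0 NE xk x1.
pose rho : R := r%:R * Num.sqrt k%:R.
have rho0 : 0 < rho by rewrite mulr_gt0 ?sqrtr_gt0 ?ltr0n.
have rho2 : rho ^+ 2 = r%:R ^+ 2 * k%:R by rewrite exprMn sqr_sqrtr ?ler0n.
pose m i := Num.truncn (`|x i| * rho).
pose z : {ffun 'I_n -> code} :=
  [ffun i => (inord (m i), (x i < 0) && (m i != 0%N))].
have x_le1 i : `|x i| <= 1.
  by rewrite -ler_sqr ?nnegrE// expr1n real_normK ?num_real// -x1 coord_le_sqnorm.
(* The bound N = r * k is generous: |x i| is at most 1 and sqrt k at most k. *)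
have mN i : (m i <= N)%N.
  have sqrt_le : Num.sqrt k%:R <= k%:R :> R.
    rewrite -{2}[k%:R]sqr_sqrtr ?ler0n// expr2 ler_peMl ?sqrtr_ge0//.
    by rewrite -[leLHS](@sqrtr1 R) ler_wsqrtr// ler1n.
  have [_ _ _ h] := rounding rho0 (erefl (m i)).
  rewrite -(ler_nat R) NE natrM (le_trans h)//.
  apply: (@le_trans _ _ rho); first by rewrite ler_piMl// ltW.
  by rewrite /rho ler_wpM2l ?ler0n.
have z1 i : ((z i).1 : nat) = m i by rewrite ffunE/= inordK// ltnS.
have yE i : net_point k r z i = (-1) ^+ (x i < 0)%R * (m i)%:R / rho.
  rewrite /net_point /code_val z1 ffunE/=.
  by case: eqP => [->|_]; rewrite ?mulr0// andbT.
have R_ i := rounding rho0 (erefl (m i)).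
have zero i : x i = 0 -> m i = 0%N by move=> x0; rewrite /m x0 normr0 mul0r truncn0.
have y0 i : x i = 0 -> net_point k r z i = 0.
  by move=> /zero m0; rewrite yE m0 mulr0 mul0r.
exists z; last split => //.
- apply/and3P; split.
  + apply: leq_trans xk; apply: subset_leq_card; apply/fintype.subsetP => i.
    rewrite !inE -val_eqE/= z1; apply: contra_neq; exact: zero.
  + rewrite -(ler_nat R) natrM natrX -rho2 natr_sum -[leRHS]mulr1 -[X in _ <= _ * X]x1 mulr_sumr.
    apply: ler_sum => i _; rewrite z1 natrX -[leRHS]exprMn_comm; last exact: mulrC.
    have [_ _ _ h] := R_ i.
    rewrite -[leRHS]real_normK ?num_real// normrM (gtr0_norm rho0) mulrC.
    by rewrite ler_sqr ?nnegrE ?ler0n ?mulr_ge0// ltW.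
  + apply/forallP => i; apply/implyP; rewrite -val_eqE/= z1 => /eqP m0.
    by rewrite ffunE/= m0 eqxx andbF.
- apply: (@le_trans _ _ (\sum_(i | x i != 0) (rho ^+ 2)^-1)).
    rewrite /sqnorm (bigID (fun i => x i != 0))/= [X in _ + X]big1 ?addr0; last first.
      by move=> i /negPn/eqP xi0; rewrite y0// xi0 subrr expr0n.
    by apply: ler_sum => i _; have [h _ _ _] := R_ i; rewrite yE.
  have r2 : 0 < r%:R ^+ 2 :> R by rewrite exprn_gt0 ?ltr0n.
  rewrite sumr_const -[leLHS]mulr_natr rho2 ler_pdivrMl ?mulr_gt0 ?ltr0n//.
  by rewrite mulrAC mulfV ?lt0r_neq0// mul1r ler_nat.
- rewrite -[leRHS]mulr1 -[X in _ <= _ * X]x1 mulr_sumr; apply: ler_sum => i _.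
  by rewrite yE; have [] := R_ i.
Qed.

End net.

(** * Control by the net and size of the net *)

Section net_bound.
Context (R : realType) (n : nat).
Implicit Types (A : 'I_n -> 'I_n -> R) (x y : 'I_n -> R).

(** If Q is the supremum of the form over sparse unit vectors, moving to the net
    costs at most (2 / r) Q, so that Q <= t + (2 / r) Q. *)
Lemma offdiag_form_net_bound A (k r : nat) (t : R) x : (0 < k)%N -> (2 < r)%N ->
  (forall z : {ffun 'I_n -> code (r * k)}, in_net k r z ->
     `|offdiag_form A (net_point R k r z)| <= t) ->
  (sparsity x <= k)%N -> sqnorm x = 1 ->
  `|offdiag_form A x| <= t / (1 - 2 / r%:R).
Proof.
move=> k0 r2 Ht xk x1.
have r0 : (0 < r)%N by exact: ltn_trans r2.
have r0R : 0 < r%:R :> R by rewrite ltr0n.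
pose S : set R := [set q | exists w : 'I_n -> R,
  [/\ (sparsity w <= k)%N, sqnorm w = 1 & q = `|offdiag_form A w|]].
have Sub : has_ubound S.
  exists (\sum_(p in pairs n) 2 * `|A p.1 p.2|) => _ [w [_ w1 ->]].
  exact: offdiag_form_le.
have Sx : S `|offdiag_form A x| by exists x.
have supP w : (sparsity w <= k)%N -> sqnorm w = 1 -> `|offdiag_form A w| <= sup S.
  by move=> wk w1; apply: (ub_le_sup Sub); exists w.
have sup0 : 0 <= sup S by apply: le_trans (supP _ xk x1).
have self : sup S <= t + 2 / r%:R * sup S.
  apply: ge_sup; first by exists `|offdiag_form A x|.
  move=> _ [w [wk w1 ->]].
  have [z zin [w0 dw sw]] := net_approx k0 r0 (erefl (r * k)%N) wk w1.
  have hom := offdiag_form_homogeneous_le supP.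
  have := offdiag_form_perturb r0R sup0 hom wk w0 dw sw.
  have := Ht z zin.
  set a := offdiag_form A w; set b := offdiag_form _ _ => bt abs.
  rewrite -(subrK b a) addrC; apply: (le_trans (ler_normD _ _)); exact: lerD.
apply: (le_trans (supP _ xk x1)).
have den : 0 < 1 - 2 / r%:R :> R.
  by rewrite subr_gt0 ltr_pdivrMr// mul1r ltr_nat.
rewrite ler_pdivlMr// mulrBr mulr1; move: self; rewrite [_ * sup S]mulrC; lra.
Qed.

Lemma sum_half_pow (N : nat) : \sum_(j < N) 2^-1 ^+ j.+1 <= 1 :> R.
Proof.
suff -> : \sum_(j < N) 2^-1 ^+ j.+1 = 1 - 2^-1 ^+ N :> R.
  by rewrite gerBl exprn_ge0.
elim: N => [|N IH]; first by rewrite big_ord0 expr0 subrr.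
by rewrite big_ord_recr/= IH exprS; lra.
Qed.

(** Give a coordinate 0 the weight 1 and a coordinate of absolute value j > 0 the
    weight (k / n) 2^-j. The weights of one coordinate sum to at most
    1 + 2 k / n, hence the product weights of all vectors to at most expR (2 k),
    whereas a net vector has product weight at least
    (k / n)^k 2^-(r^2 k) by its sparsity and its norm. *)
Lemma card_net (k r N : nat) : (0 < k)%N -> (k <= n)%N ->
  #|[pred z : {ffun 'I_n -> code N} | in_net k r z]|%:R <=
  expR ((r ^ 2 * k)%:R + k%:R * ln (n%:R / k%:R) + 2 * k%:R) :> R.
Proof.
move=> k0 kn.
have n0 : (0 < n)%N by exact: leq_trans kn.
have kR : 0 < k%:R :> R by rewrite ltr0n.
have nR : 0 < n%:R :> R by rewrite ltr0n.
pose lam : R := k%:R / n%:R.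
have lam0 : 0 < lam by rewrite divr_gt0.
have lam1 : lam <= 1 by rewrite ler_pdivrMr// mul1r ler_nat.
pose h : R := 2^-1.
have h0 : 0 <= h by rewrite invr_ge0.
pose f (c : code N) : R :=
  if c.1 == ord0 then (~~ c.2)%:R else lam * h ^+ c.1.
have f0 c : 0 <= f c.
  by rewrite /f; case: ifP => // _; rewrite mulr_ge0 ?exprn_ge0 ?(ltW lam0).
have sumf : \sum_c f c <= 1 + 2 * lam.
  rewrite -(pair_bigA _ (fun a b => f (a, b)))/= big_ord_recl/=.
  rewrite [X in X + _]big_bool /f /= add0r lerD2l.
  under eq_bigr => j _.
    rewrite big_bool/= /bump/= add1n.
    have -> : lam * h ^+ j.+1 + lam * h ^+ j.+1 = 2 * lam * h ^+ j.+1 by ring.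
    over.
  rewrite -mulr_sumr ler_piMr ?sum_half_pow// mulr_ge0//; exact: ltW.
have weight z : in_net k r z -> lam ^+ k * h ^+ (r ^ 2 * k) <= \prod_i f (z i).
  move=> /and3P[zk zr /forallP z0].
  have -> : \prod_i f (z i) =
      lam ^+ #|[pred i | (z i).1 != ord0]| * h ^+ (\sum_i (z i).1).
    rewrite -prodr_const [in RHS]big_mkcond -prodrXr -big_split/=.
    apply: eq_bigr => i _; rewrite inE /f.
    have := z0 i; case: eqP => /= [-> /negbTE ->|_ _] //.
    by rewrite mul1r expr0.
  apply: ler_pM; rewrite ?exprn_ge0//; first exact: ltW.
    by apply: ler_wiXn2l => //; exact: ltW.
  apply: ler_wiXn2l => //; first by rewrite /h; lra.
  apply: leq_trans zr; apply: leq_sum => i _.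
  by case: ((z i).1 : nat) => // m; rewrite expnS expn1 leq_pmulr.
have total : #|[pred z : {ffun 'I_n -> code N} | in_net k r z]|%:R *
    (lam ^+ k * h ^+ (r ^ 2 * k)) <= expR (2 * k%:R).
  rewrite mulr_natl -sumr_const.
  apply: (@le_trans _ _ (\sum_(z : {ffun 'I_n -> code N}) \prod_i f (z i))).
    rewrite big_mkcond; apply: ler_sum => z _; case: ifP => [|_]; first exact: weight.
    by apply: prodr_ge0 => i _.
  rewrite -(bigA_distr_bigA (fun=> f)) prodr_const card_ord.
  apply: (@le_trans _ _ (expR (2 * lam) ^+ n)).
    apply: lerXn2r; rewrite ?nnegrE ?expR_ge0 ?sumr_ge0//.
    exact: le_trans sumf (expR_ge1Dx _).
  rewrite -expRM_natr ler_expR le_eqVlt; apply/orP; left; apply/eqP.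
  by rewrite /lam; field; exact: lt0r_neq0.
have lamE : lam ^+ k = expR (- (k%:R * ln (n%:R / k%:R))).
  by rewrite -mulrN -lnV ?posrE ?divr_gt0// invf_div expRM_natl lnK.

have hE : expR (- (r ^ 2 * k)%:R) <= h ^+ (r ^ 2 * k) :> R.
  rewrite -[X in - X]mulr1 -mulrN expRM_natl.
  apply: lerXn2r; rewrite ?nnegrE ?expR_ge0 ?/h ?invr_ge0//.
  rewrite expRN lef_pV2 ?posrE ?expR_gt0//.
  exact: expR_ge1Dx.
have low : expR (- (k%:R * ln (n%:R / k%:R)) - (r ^ 2 * k)%:R) <= lam ^+ k * h ^+ (r ^ 2 * k).
  by rewrite expRD lamE ler_wpM2l ?expR_ge0.
rewrite -(ler_pM2r (expR_gt0 (- (k%:R * ln (n%:R / k%:R)) - (r ^ 2 * k)%:R))).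
apply: (le_trans (ler_wpM2l _ low)); first exact: ler0n.
apply: (le_trans total); rewrite -expRD ler_expR; lra.
Qed.

End net_bound.

(** * Union bound for Gaussian variables *)

Section union_bound.
Context d (T : measurableType d) (R : realType) (P : probability T R).

Lemma measurable_exists (I : finType) (Z : pred I) (B : I -> set T) :
  (forall i, measurable (B i)) -> measurable [set t | exists2 i, Z i & B i t].
Proof.
move=> mB.
have -> : [set t | exists2 i, Z i & B i t] = \bigcup_(i in [set` Z]) B i.
  by apply/seteqP; split=> t [i Zi Bit]; exists i.
exact: fin_bigcup_measurable.
Qed.

(** The sum over i and both signs of the exponentials expR (l (+-Y i - s)) is at
    least 1 on the event, which gives the union bound and the Chernoff bounds
    together. *)
Lemma gaussian_union_bound (I : finType) (Z : pred I) (Y : I -> T -> R) (V l s : R) :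
  (forall i, measurable_fun setT (Y i)) ->
  (forall i, Z i -> exists2 v, v <= V & gaussian_mgf P (Y i) v) -> 0 <= l ->
  (P [set t | exists2 i, Z i & (s <= `|Y i t|)%R] <=
   (2 * #|Z|%:R * expR (l ^+ 2 * V / 2 - l * s))%:E)%E.
Proof.
move=> mY mgfY l0.
pose g (i : I) t : R := expR (l * Y i t) + expR (- l * Y i t).
have mg i : measurable_fun setT (g i).
  by apply: measurable_funD; exact: measurable_expR_scale.
have g0 i t : 0 <= g i t by rewrite addr_ge0 ?expR_ge0.
have intg i : Z i -> (\int[P]_t (g i t)%:E <= (2 * expR (l ^+ 2 * V / 2))%:E)%E.
  move=> /mgfY[v vV mgf].
  rewrite /g; under eq_integral do rewrite EFinD.
  rewrite ge0_integralD//.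
  - rewrite !mgf sqrrN -EFinD lee_fin mulr_natl mulr2n.
    by apply: lerD; rewrite ler_expR ler_pM2r// ler_wpM2l ?sqr_ge0.
  - by apply/measurable_EFinP; exact: measurable_expR_scale.
  - by apply/measurable_EFinP; exact: measurable_expR_scale.
pose G t : R := expR (- (l * s)) * \sum_(i | Z i) g i t.
have mS : measurable_fun setT (fun t => \sum_(i | Z i) g i t).
  under eq_fun do rewrite big_mkcond.
  by apply: measurable_sum => i; case: (Z i).
apply: (@le_trans _ _ (\int[P]_t (G t)%:E)%E).
  apply: prob_le_integral.
  - apply: measurable_exists => i; apply: measurable_ge.
    exact: measurableT_comp.
  - exact: measurable_funM.
  - by move=> t; rewrite mulr_ge0 ?expR_ge0 ?sumr_ge0.
  - move=> t [i Zi sY]; rewrite /G (bigD1 i)//= mulrDr -[leLHS]addr0.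
    apply: lerD; last by rewrite mulr_ge0 ?expR_ge0 ?sumr_ge0.
    rewrite /g mulrDr -!expRD.
    have [Y0|Y0] := lerP 0 (Y i t).
      rewrite -[leLHS]addr0; apply: lerD; last exact: expR_ge0.
      rewrite -expR0 ler_expR addrC subr_ge0 ler_wpM2l//.
      by move: sY; rewrite ger0_norm.
    rewrite -[leLHS]add0r; apply: lerD; first exact: expR_ge0.
    rewrite -expR0 ler_expR addrC mulNr -mulrN subr_ge0 ler_wpM2l//.
    by move: sY; rewrite ltr0_norm.
rewrite /G; under eq_integral do rewrite EFinM -sumEFin.
rewrite ge0_integralZl_EFin ?expR_ge0//; last 2 first.
- by move=> t _; apply: sume_ge0 => i _; rewrite lee_fin.
- under eq_fun do rewrite sumEFin.
  exact/measurable_EFinP.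
have -> : (\int[P]_t (\sum_(i | Z i) (g i t)%:E) =
    \sum_(i | Z i) \int[P]_t (g i t)%:E)%E.
  rewrite -big_filter; under eq_integral do rewrite -big_filter.
  by rewrite ge0_integral_sum// => i; [exact/measurable_EFinP|move=> t _; rewrite lee_fin].
have -> : 2 * #|Z|%:R * expR (l ^+ 2 * V / 2 - l * s) =
    expR (- (l * s)) * \sum_(i | Z i) 2 * expR (l ^+ 2 * V / 2).
  rewrite sumr_const -[X in _ = _ * X]mulr_natr expRD. ring.
rewrite EFinM lee_wpmul2l ?lee_fin ?expR_ge0//.
by rewrite -sumEFin; apply: lee_sum => i Zi; exact: intg.
Qed.

End union_bound.

(** * Greedy selection of a sparse vector *)

Section greedy.
Context (R : realType) (n k : nat) (tau : R).
Implicit Types (a : 'I_n -> 'I_n -> R) (S : {set 'I_n}) (v i : 'I_n).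

(** Vertices are inserted one at a time, and the r-th one gets this coordinate. The
    squared norm after r insertions is then sqrt r, and the gain in the quadratic
    form, 2 times increment r times a Gaussian of variance sqrt r, has size
    asymptotically independent of r. Equal coordinates would fall short of the
    optimal constant by the factor 2 sqrt 2 / 3. *)
Definition increment (r : nat) : R := Num.sqrt (Num.sqrt r.+1%:R - Num.sqrt r%:R).

(** The insertion order of a set is the order of its elements, so that a set
    determines its weights. *)
Definition rank S i : nat := #|[set j in S | (j < i)%N]%SET|.

Definition weight S i : R := increment (rank S i).

Definition weight_vector S i : R := if i \in S then weight S i else 0.

Definition score a S v : R := \sum_(i in S | (i < v)%N) weight S i * a i v.

(** The score of v has variance sqrt #|S|; it is compared with tau standard
    deviations. *)
Definition threshold S : R := tau * Num.sqrt (Num.sqrt #|S|%:R).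

Definition accepts a S v : bool := (#|S| < k)%N && (threshold S <= score a S v).

Definition step a v S : {set 'I_n} := if accepts a S v then v |: S else S.

(** The set selected from the first m vertices: v is decided by the entries of
    column v above the diagonal, which are independent of all earlier decisions. *)
Fixpoint grow a (m : nat) : {set 'I_n} :=
  if m is m'.+1 then
    if insub m' is Some v then step a v (grow a m') else grow a m'
  else finset.set0.

Definition below S (m : nat) : Prop := forall i, i \in S -> (i < m)%N.

Lemma below_notin S v : below S v -> v \notin S.
Proof. by move=> Sv; apply/negP => /Sv; rewrite ltnn. Qed.

Lemma increment_sqr r :
  increment r ^+ 2 = Num.sqrt r.+1%:R - Num.sqrt r%:R.
Proof. by rewrite sqr_sqrtr// subr_ge0 ler_wsqrtr// ler_nat. Qed.

(** Inserting the largest element leaves the earlier coordinates unchanged. *)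
Lemma weight_vectorU S v : below S v -> forall i,
  weight_vector (v |: S) i = if i == v then increment #|S| else weight_vector S i.
Proof.
move=> Sv i; have vS := below_notin Sv.
have rankE (j : 'I_n) : (j <= v)%N -> rank (v |: S) j = rank S j.
  move=> jv; rewrite /rank; apply: eq_card => l; rewrite !inE.
  by case: eqP => //= -> ; rewrite ltnNge jv (negbTE vS).
rewrite /weight_vector in_setU1; case: eqP => [->|_] /=.
  rewrite /weight rankE// /rank; congr (increment _).
  apply: eq_card => j; rewrite !inE; case: (boolP (j \in S)) => //= jS; exact: Sv.
by case: ifP => // iS; rewrite /weight rankE// ltnW// Sv.
Qed.

Lemma sqnorm_weight_vectorU S v : below S v ->
  sqnorm (weight_vector (v |: S)) = sqnorm (weight_vector S) + increment #|S| ^+ 2.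
Proof.
move=> Sv; have wE := weight_vectorU Sv; have vS := below_notin Sv.
rewrite /sqnorm (bigD1 v)//= [in RHS](bigD1 v)//= wE eqxx.
rewrite [in RHS]/weight_vector (negbTE vS) expr0n add0r addrC; congr (_ + _).
by apply: eq_bigr => i /negbTE iv; rewrite wE iv.
Qed.

Lemma offdiag_weight_vectorU a S v : below S v ->
  offdiag_form a (weight_vector (v |: S)) =
  offdiag_form a (weight_vector S) + 2 * increment #|S| * score a S v.
Proof.
move=> Sv; have wE := weight_vectorU Sv; have vS := below_notin Sv.
have w0 (j : 'I_n) : (v <= j)%N -> weight_vector S j = 0.
  move=> vj; rewrite /weight_vector ifF//; apply/negP => /Sv.
  by rewrite ltnNge vj.
rewrite /offdiag_form (bigID (fun p : 'I_n * 'I_n => p.2 == v))/=.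
rewrite [in RHS](bigID (fun p : 'I_n * 'I_n => p.2 == v))/=.
rewrite [X in _ = X + _ + _]big1 ?add0r; last first.
  by move=> p /andP[_ /eqP ->]; rewrite (w0 v)// mulr0 mulr0 mul0r.
rewrite addrC; congr (_ + _).
  apply: eq_bigr => p /andP[]; rewrite inE => p12 p2v.
  rewrite !wE (negbTE p2v); case: eqP => // p1v.
  by rewrite (w0 p.2) ?mulr0// -p1v ltnW.
rewrite /score mulr_sumr (reindex_onto (fun i : 'I_n => (i, v)) fst)/=; last first.
  by move=> [i j] /= /andP[_ /eqP ->].
rewrite big_mkcond [RHS]big_mkcond/=; apply: eq_bigr => i _.
rewrite inE/= !eqxx !andbT !wE eqxx; case: (ltnP i v) => iv; last by rewrite andbF.
rewrite andbT ifF; last by apply/negP => /eqP iv'; rewrite iv' ltnn in iv.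
rewrite /weight_vector; case: ifP => iS; first by ring.
by rewrite mul0r mulr0 mul0r.
Qed.

Definition gain (r : nat) : R := increment r * Num.sqrt (Num.sqrt r%:R).

Lemma grow_invariant a m :
  [/\ below (grow a m) m, (#|grow a m| <= k)%N,
      sqnorm (weight_vector (grow a m)) = Num.sqrt #|grow a m|%:R &
      2 * tau * (\sum_(r < #|grow a m|) gain r) <=
        offdiag_form a (weight_vector (grow a m))].
Proof.
elim: m => [|m [Hb Hk Hs Ho]] /=.
  rewrite cards0 big_ord0 mulr0 sqrtr0 /sqnorm /offdiag_form; split => //.
  - by move=> i; rewrite inE.
  - by rewrite big1// => i _; rewrite /weight_vector inE expr0n.
  - by rewrite big1// => p _; rewrite /weight_vector inE mul0r mulr0 mul0r.
case: insubP => [v _ vm|_]; last by split=> // i /Hb/ltnW.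
move: Hb Hk Hs Ho; rewrite -vm; set S := grow a v => bS Hk Hs Ho.
rewrite /step; case: ifP => [/andP[Sk thr]|_]; last first.
  by split => // i /bS/ltnW.
have cU : #|v |: S| = #|S|.+1 by rewrite cardsU1 below_notin.
split.
- by move=> i; rewrite in_setU1 => /orP[/eqP ->//|/bS/ltnW].
- by rewrite cU.
- by rewrite sqnorm_weight_vectorU// Hs increment_sqr cU addrC subrK.
- rewrite cU big_ord_recr/= offdiag_weight_vectorU// mulrDr; apply: lerD => //.
  have inc0 : 0 <= 2 * increment #|S| by rewrite mulr_ge0 ?sqrtr_ge0.
  by have := ler_wpM2l inc0 thr; rewrite /threshold /gain; lra.
Qed.

(** With a and b the square roots of r and r + 1, the gain g satisfies
    g ^+ 2 = (b - a) a = (1 - (b - a) ^+ 2) / 2. In particular sqrt 2 * g <= 1,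
    so that g >= sqrt 2 * g ^+ 2, and (b - a) ^+ 2 <= b - a leaves a telescoping
    error. *)
Lemma gain_ge (r : nat) :
  Num.sqrt 2 / 2 * (1 - (Num.sqrt r.+1%:R - Num.sqrt r%:R)) <= gain r.
Proof.
rewrite /gain /increment -sqrtrM; last first.
  by rewrite subr_ge0 ler_wsqrtr// ler_nat.
have a2 : Num.sqrt r%:R ^+ 2 = r%:R :> R by rewrite sqr_sqrtr.
have b2 : Num.sqrt r.+1%:R ^+ 2 = r%:R + 1 :> R by rewrite sqr_sqrtr// natr1.
have a0 := sqrtr_ge0 (r%:R : R).
have b1 : 1 <= Num.sqrt r.+1%:R :> R.
  by rewrite -[leLHS](@sqrtr1 R) ler_wsqrtr// ler1n.
have ab : Num.sqrt r%:R <= Num.sqrt r.+1%:R :> R by rewrite ler_wsqrtr// ler_nat.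
set a := Num.sqrt r%:R in a2 a0 ab *; set b := Num.sqrt r.+1%:R in b2 b1 ab *.
have g2 : Num.sqrt ((b - a) * a) ^+ 2 = (b - a) * a.
  by rewrite sqr_sqrtr// mulr_ge0// subr_ge0.
have g0 := sqrtr_ge0 ((b - a) * a).
set g := Num.sqrt ((b - a) * a) in g2 g0 *.
have s2 : Num.sqrt 2 ^+ 2 = 2 :> R by rewrite sqr_sqrtr.
have s0 : 0 <= Num.sqrt 2 :> R by exact: sqrtr_ge0.
set s := Num.sqrt 2 in s2 s0 *.
have diff : (b - a) * (b + a) = 1 by rewrite -subr_sqr a2 b2; ring.
have ba1 : b - a <= 1 by nra.
have sg1 : s * g <= 1.
  rewrite -(@ler_sqr _ (s * g)) ?nnegrE ?mulr_ge0// exprMn s2 g2 expr1n.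
  by nra.
have gg : s * g ^+ 2 <= g.
  by rewrite expr2 mulrA ler_piMl.
apply: le_trans gg; rewrite g2 -mulrA; apply: ler_wpM2l => //.
by nra.
Qed.

Lemma sum_gain_ge (m : nat) :
  Num.sqrt 2 / 2 * (m%:R - Num.sqrt m%:R) <= \sum_(r < m) gain r.
Proof.
elim: m => [|m IH]; first by rewrite big_ord0 sqrtr0 subr0 mulr0.
rewrite big_ord_recr/=; apply: le_trans (lerD IH (gain_ge m)).
by rewrite -natr1 -mulrDr le_eqVlt; apply/orP; left; apply/eqP; congr (_ * _); ring.
Qed.

End greedy.

(** * The greedy selection succeeds with high probability *)

Section greedy_probability.
Context d (T : measurableType d) (R : realType) (P : probability T R).
Context (n k : nat) (tau : R) (A : 'I_n -> 'I_n -> {RV P >-> R}).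
Hypothesis tau0 : 0 <= tau.
Hypothesis indep : mutually_independent
  [pred ij : 'I_n * 'I_n | (ij.1 <= ij.2)%N] (fun ij => A ij.1 ij.2).
Hypothesis law : forall i j : 'I_n, (i < j)%N -> has_normal_law (A i j) 0 1.

Let X (p : 'I_n * 'I_n) := A p.1 p.2.
Let a t (i j : 'I_n) : R := A i j t.
Let H m t : {set 'I_n} := grow k tau (a t) m.

(* The entries that decide the selection among the first m vertices, and those
   that decide the score of v against S. *)
Let past m : {set 'I_n * 'I_n} :=
  [set p : 'I_n * 'I_n | (p.1 < p.2)%N && (p.2 < m)%N]%SET.
Let column (S : {set 'I_n}) (v : 'I_n) : {set 'I_n * 'I_n} :=
  [set p : 'I_n * 'I_n | (p.1 \in S) && (p.1 < p.2)%N && (p.2 == v)]%SET.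

Lemma score_linear_sum t S (v : 'I_n) :
  score (a t) S v = linear_sum X (column S v) (fun p => weight R S p.1) t.
Proof.
rewrite /score /linear_sum [RHS](reindex_onto (fun i : 'I_n => (i, v)) fst)/=; last first.
  by move=> [i j] /=; rewrite inE /= => /andP[_ /eqP ->].
by apply: eq_bigl => i; rewrite inE/= !eqxx !andbT.
Qed.

Let passes (S : {set 'I_n}) (v : 'I_n) : set T := [set t | threshold tau S <= score (a t) S v].

Lemma known_passes S v : <<s rectangles X (column S v) >> (passes S v).
Proof.
have -> : passes S v =
    linear_sum X (column S v) (fun p => weight R S p.1) @^-1` `[threshold tau S, +oo[.
  by apply/seteqP; split => t /=; rewrite in_itv/= andbT -score_linear_sum.
by apply: known_preimage => //; exact: known_linear_sum.
Qed.

(** The selection takes finitely many values S, and on the event that its value is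
    S the next decision is read off from the score of the new vertex against S. *)
Lemma known_grow m S : <<s rectangles X (past m) >> [set t | H m t = S].
Proof.
elim: m S => [|m IH] S.
  have -> : [set t | H 0 t = S] = if S == finset.set0 then setT else set0.
    apply/seteqP; split => t; rewrite /H /=; first by move=> <-; rewrite eqxx.
    by case: eqP.
  by case: eqP => _; [exact: (@measurableT _ (known_from X (past 0)))
                    |exact: (@measurable0 _ (known_from X (past 0)))].
have sub : past m \subset past m.+1.
  by apply/fintype.subsetP => p; rewrite !inE => /andP[-> /= h]; exact: ltnW.
rewrite /H /=; case: insubP => [v _ vm|_]; last exact: known_mono (IH S).
have -> : [set t | step k tau (a t) v (grow k tau (a t) m) = S] =
    \bigcup_(S' in [set: {set 'I_n}])
      ([set t | H m t = S'] `&` [set t | step k tau (a t) v S' = S]).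
  apply/seteqP; split => t /=; first by move=> <-; exists (H m t).
  by move=> [S' _ [<- ]].
apply: (@fin_bigcup_measurable _ (known_from X (past m.+1))) => // S' _.
apply: (@measurableI _ (known_from X (past m.+1))).
  exact: known_mono (IH S').
have kp : <<s rectangles X (past m.+1) >> (passes S' v).
  apply: (@known_mono _ _ _ _ _ X (column S' v)); last exact: known_passes.
  apply/fintype.subsetP => p.
  by rewrite !inE => /andP[/andP[_ ->] /eqP ->]; rewrite vm ltnS leqnn.
have -> : [set t | step k tau (a t) v S' = S] =
    (if (#|S'| < k)%N && (v |: S' == S) then passes S' v else set0) `|`
    (if S' == S then (if (#|S'| < k)%N then ~` passes S' v else setT) else set0).
  rewrite /step /accepts /passes; apply/seteqP; split => t /=.
    case: ltnP => /= _.
      case: ifP => [th <-|/negP th <-]; rewrite eqxx; first by left.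
      by right.
    by move=> ->; rewrite eqxx; right.
  case: ltnP => /= _.
    move=> [|]; first by case: eqP => // <- /= ->.
    by case: eqP => // <- /= /negP/negbTE ->.
  by move=> [//|]; case: eqP.
apply: (@measurableU _ (known_from X (past m.+1))).
  by case: ifP => _ //; exact: (@measurable0 _ (known_from X (past m.+1))).
case: ifP => _; last exact: (@measurable0 _ (known_from X (past m.+1))).
case: ifP => _; last exact: (@measurableT _ (known_from X (past m.+1))).
exact: (@measurableC _ (known_from X (past m.+1))).
Qed.

Lemma measurable_grow m S : measurable [set t | H m t = S].
Proof. apply: (@known_measurable _ _ _ _ _ X (past m)); exact: known_grow. Qed.

(** The lower tail bound of a standard Gaussian at tau. *)
Definition success_bound : R := expR (- (tau ^+ 2 / 2 + 4 * tau + 6)) / 2.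

(** A set S that occurs as a selection satisfies the invariant, and its score is
    Gaussian of variance sqrt #|S|. The case of the empty set is degenerate:
    score and threshold are both 0. *)
Lemma passes_prob_ge m S (v : 'I_n) t : v = m :> nat -> H m t = S ->
  (success_bound%:E <= P (passes S v))%E.
Proof.
move=> vm HS.
have [] := grow_invariant k tau (a t) m; rewrite -/(H m t) HS => Sb _ Sn _.
have mpass : measurable (passes S v).
  by apply: (@known_measurable _ _ _ _ _ X (column S v)); exact: known_passes.
have [S0|S0] := eqVneq #|S| 0%N.
  have -> : passes S v = setT.
    apply/seteqP; split => // u _; rewrite /passes/= /threshold /score S0 !sqrtr0 mulr0.
    rewrite big1// => i /andP[]; have := cards0_eq S0 => ->.
    by rewrite inE.
  rewrite probability_setT lee_fin /success_bound ler_pdivrMr// mul1r.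
  apply: (@le_trans _ _ 1); last by rewrite ler1n.
  by rewrite -[leRHS]expR0 ler_expR oppr_le0 !addr_ge0 ?mulr_ge0 ?sqr_ge0.
have n0 : 0 < Num.sqrt (Num.sqrt #|S|%:R) :> R by rewrite !sqrtr_gt0 ltr0n lt0n.
set s := Num.sqrt _ in n0.
pose Y u := linear_sum X (column S v) (fun p => s^-1 * weight R S p.1) u.
have YE u : Y u = s^-1 * score (a u) S v.
  rewrite score_linear_sum /Y /linear_sum mulr_sumr; apply: eq_bigr => p _.
  by rewrite mulrA.
have -> : passes S v = [set u | tau <= Y u].
  apply/seteqP; split => u /=; rewrite /passes /threshold -/s /= YE.
    by rewrite ler_pdivlMl// mulrC.
  by rewrite ler_pdivlMl// mulrC.
apply: gaussian_lower_tail => //; first exact: measurable_linear_sum.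
have colD : column S v \subset [pred ij : 'I_n * 'I_n | (ij.1 <= ij.2)%N].
  by apply/fintype.subsetP => p; rewrite !inE => /andP[/andP[_ /ltnW]].
have -> : 1 = \sum_(p in column S v) (s^-1 * weight R S p.1) ^+ 2 :> R.
  have -> : \sum_(p in column S v) (s^-1 * weight R S p.1) ^+ 2 =
      \sum_i (s^-1 * weight_vector R S i) ^+ 2.
    rewrite (reindex_onto (fun i : 'I_n => (i, v)) fst)/=; last first.
      by move=> [i j] /=; rewrite inE /= => /andP[_ /eqP ->].
    rewrite big_mkcond; apply: eq_bigr => i _; rewrite inE/= !eqxx !andbT /weight_vector.
    case: (boolP (i \in S)) => [iS|_] /=; last by rewrite mulr0 expr0n.
    by rewrite vm Sb.
  rewrite -/(sqnorm (fun i => s^-1 * weight_vector R S i)) sqnormZ Sn.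
  by rewrite exprVn sqr_sqrtr ?sqrtr_ge0// mulVf// gt_eqF// sqrtr_gt0 ltr0n lt0n.
apply: (linear_sum_mgf indep) => //.
by move=> p; rewrite inE => /andP[/andP[_ p12] _]; exact: law.
Qed.

(* Bounded by 1, and halved at least by each insertion. *)
Let potential (S : {set 'I_n}) : R := if (#|S| < k)%N then 2^-1 ^+ #|S| else 0.

Lemma potential_ge0 S : 0 <= potential S.
Proof. by rewrite /potential; case: ifP => // _; rewrite exprn_ge0. Qed.

Lemma sum_grow_indic (f : {set 'I_n} -> R) m t :
  f (H m t) = \sum_S f S * \1_[set u | H m u = S] t.
Proof.
rewrite (bigD1 (H m t))//= indicE mem_set// mulr1 big1 ?addr0// => S neS.
rewrite indicE memNset ?mulr0//= => HS.
by rewrite HS eqxx in neS.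
Qed.

Lemma measurable_fun_grow (f : {set 'I_n} -> R) m :
  measurable_fun setT (fun t => f (H m t)).
Proof.
under eq_fun do rewrite sum_grow_indic.
apply: measurable_sum => S; apply: measurable_funM => //.
by apply: measurable_indic; exact: measurable_grow.
Qed.

Lemma integral_grow (f : {set 'I_n} -> R) m : (forall S, 0 <= f S) ->
  (\int[P]_t (f (H m t))%:E =
   \sum_S (f S)%:E * P [set u | H m u = S])%E.
Proof.
move=> f0; under eq_integral do rewrite sum_grow_indic -sumEFin.
rewrite ge0_integral_sum//.
- apply: eq_bigr => S _; under eq_integral do rewrite EFinM.
  rewrite ge0_integralZl_EFin// ?integral_indic ?setIT//; first exact: measurable_grow.
  by apply/measurable_EFinP/measurable_indic; exact: measurable_grow.
- move=> S; apply/measurable_EFinP/measurable_funM => //.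
  by apply: measurable_indic; exact: measurable_grow.
- by move=> S t _; rewrite lee_fin mulr_ge0.
Qed.

(** Condition on the value S of the selection. Passing the test is independent of
    that event and halves the potential, so that its mean decreases by the factor
    1 - q / 2 with q the probability of passing. *)
Lemma potential_step m (mn : (m < n)%N) :
  (\int[P]_t (potential (H m.+1 t))%:E <=
   (1 - success_bound / 2)%:E * \int[P]_t (potential (H m t))%:E)%E.
Proof.
pose v := Ordinal mn.
pose E S := [set u | H m u = S].
pose F S t : R := \1_(E S) t * (1 - \1_(passes S v) t / 2).
have mE S : measurable (E S) by exact: measurable_grow.
have mpass S : measurable (passes S v).
  by apply: (@known_measurable _ _ _ _ _ X (column S v)); exact: known_passes.
have V0 S t : 0 <= 1 - \1_(passes S v) t / 2 :> R.
  by rewrite indicE; case: (_ \in _) => /=; lra.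
have F0 S t : 0 <= F S t by rewrite mulr_ge0.
have mV S : measurable_fun setT (fun t => 1 - \1_(passes S v) t / 2 : R).
  by apply: measurable_funB => //; apply: measurable_funM => //; exact: measurable_indic.
have mF S : measurable_fun setT (F S).
  by apply: measurable_funM => //; exact: measurable_indic.
have pointwise t : potential (H m.+1 t) <= \sum_S potential S * F S t.
  rewrite (bigD1 (H m t))//= -[leLHS]addr0; apply: lerD; last first.
    by apply: sumr_ge0 => S _; rewrite mulr_ge0 ?potential_ge0.
  rewrite /F indicE mem_set// mul1r indicE.
  have [Sb _ _ _] := grow_invariant k tau (a t) m; rewrite -/(H m t) in Sb.
  have vS : v \notin H m t by apply: below_notin.
  rewrite {1}/H /= insubT -/(H m t) /step /accepts -/v.
  rewrite /potential; set S := H m t in vS *.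
  case: (ltnP #|S| k) => Sk /=; last by rewrite ltnNge Sk /= mul0r.
  case: (boolP (threshold tau S <= score (a t) S v)) => th.
    rewrite mem_set// cardsU1 vS /= exprS.
    have h0 : 0 <= 2^-1 ^+ #|S| :> R by rewrite exprn_ge0.
    by case: ifP => _; lra.
  by rewrite memNset ?Sk ?mul0r ?subr0 ?mulr1//; exact/negP.
apply: (@le_trans _ _ (\int[P]_t (\sum_S potential S * F S t)%:E)%E).
  apply: ge0_le_integral => //.
  - by move=> t _; rewrite lee_fin potential_ge0.
  - by apply/measurable_EFinP; exact: measurable_fun_grow.
  - apply/measurable_EFinP; apply: measurable_sum => S.
    exact: measurable_funM.
  - by move=> t _; rewrite lee_fin.
under eq_integral do rewrite -sumEFin.
rewrite ge0_integral_sum//; last 2 first.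
- by move=> S; apply/measurable_EFinP; exact: measurable_funM.
- by move=> S t _; rewrite lee_fin mulr_ge0 ?potential_ge0.
rewrite integral_grow; last exact: potential_ge0.
rewrite ge0_sume_distrr; last first.
  by move=> S _; rewrite mule_ge0 ?lee_fin ?potential_ge0.
apply: lee_sum => S _.
under eq_integral do rewrite EFinM.
rewrite ge0_integralZl_EFin ?potential_ge0//; last 2 first.
- by move=> t _; rewrite lee_fin.
- exact/measurable_EFinP.
rewrite muleCA lee_wpmul2l ?lee_fin ?potential_ge0//.
(* The success bound is available only for the sets S that do occur. *)
have [[t HS]|noS] := pselect (exists t, H m t = S); last first.
  have E0 : E S = set0 by apply/seteqP; split => // t HS; case: noS; exists t.
  rewrite -/(E S) E0 measure0 mule0 /F E0.
  by under eq_integral do rewrite indicE in_set0 mul0r; rewrite integral0.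
have vm : v = m :> nat by [].
have q_le := passes_prob_ge vm HS.
have intV : (\int[P]_u (1 - \1_(passes S v) u / 2)%:E <= (1 - success_bound / 2)%:E)%E.
  have VE u : 1 - \1_(passes S v) u / 2 =
      2^-1 * \1_(passes S v) u + \1_(~` passes S v) u :> R.
    by rewrite !indicE in_setC; case: (_ \in _) => /=; lra.
  under eq_integral do rewrite VE EFinD EFinM.
  have mi (B : set T) : measurable B -> measurable_fun setT (fun u => (\1_B u)%:E : \bar R).
    by move=> mB; apply/measurable_EFinP; exact: measurable_indic.
  have mh : measurable_fun [set: T] (fun u : T => (2^-1)%:E * (\1_(passes S v) u)%:E : \bar R)%E.
    by apply: emeasurable_funM => //; exact: mi.
  have h0 u : (0 <= (2^-1)%:E * (\1_(passes S v) u)%:E :> \bar R)%E.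
    by rewrite -EFinM lee_fin mulr_ge0.
  rewrite ge0_integralD//; last by apply: mi; exact: measurableC.
  rewrite ge0_integralZl_EFin//; last exact: mi.
  have -> : (\int[P]_u (\1_(passes S v) u)%:E = P (passes S v))%E.
    by rewrite integral_indic// setIT.
  have -> : (\int[P]_u (\1_(~` passes S v) u)%:E = 1 - P (passes S v))%E.
    rewrite integral_indic ?setIT//; last exact: measurableC.
    exact: probability_setC.
  move: q_le; rewrite -[P (passes S v)]fineK; last exact: fin_num_measure.
  by rewrite -EFinB -EFinM -EFinD !lee_fin; lra.
rewrite /F integralM_independent//.
- rewrite integral_indic// setIT muleC; exact: lee_wpmul2r.
- move=> B C mB mC.
  have mEk : <<s rectangles X (past m) >> (E S) by exact: known_grow.
  have mPk : <<s rectangles X (column S v) >> (passes S v) by exact: known_passes.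
  apply: (mutually_independent_groups (J := past m) (K := column S v) indep).
  + by apply/fintype.subsetP => p; rewrite !inE => /andP[/ltnW].
  + by apply/fintype.subsetP => p; rewrite !inE => /andP[/andP[_ /ltnW]].
  + move=> p; rewrite !inE => /andP[_ p2m]; apply/negP => /andP[_ /eqP p2v].
    by rewrite p2v /= ltnn in p2m.
  + apply: (known_preimage (J := past m)) mB.
    exact: (@measurable_indic _ (known_from X (past m)) R setT (E S) mEk).
  + apply: (known_preimage (J := column S v)) mC.
    apply: (@measurable_funB _ (known_from X (column S v))) => //.
    exact: (@measurable_funM _ (known_from X (column S v))).
Qed.

Lemma success_bound_bounds : 0 <= success_bound <= 1.
Proof.
apply/andP; split; first by rewrite divr_ge0 ?expR_ge0.
rewrite /success_bound ler_pdivrMr// mul1r.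
apply: (@le_trans _ _ 1); last by rewrite ler1n.
by rewrite -[leRHS]expR0 ler_expR oppr_le0 !addr_ge0 ?mulr_ge0 ?sqr_ge0.
Qed.

Lemma potential_decay m : (m <= n)%N ->
  (\int[P]_t (potential (H m t))%:E <= ((1 - success_bound / 2) ^+ m)%:E)%E.
Proof.
have /andP[q0 q1] := success_bound_bounds.
elim: m => [_|m IH mn].
  rewrite expr0; apply: (@le_trans _ _ (\int[P]_t 1%:E)%E).
    apply: ge0_le_integral => //.
    - by move=> t _; rewrite lee_fin potential_ge0.
    - by apply/measurable_EFinP; exact: (measurable_fun_grow potential 0).
    - move=> t _; rewrite lee_fin /potential; case: ifP => // _.
      by apply: exprn_ile1; lra.
  rewrite integral_cst// mul1e.
  by rewrite (_ : _ setT = 1%E)//; exact: probability_setT.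
apply: (le_trans (potential_step mn)).
rewrite exprS EFinM; apply: lee_wpmul2l; last by apply: IH; exact: ltnW.
rewrite lee_fin; lra.
Qed.

Lemma measurable_grow_small : measurable [set t | (#|H n t| < k)%N].
Proof.
have -> : [set t | (#|H n t| < k)%N] =
    [set t | exists2 S : {set 'I_n}, (#|S| < k)%N & [set u | H n u = S] t].
  by apply/seteqP; split => t /=; [move=> h; exists (H n t)|move=> [S h ->]].
by apply: (@measurable_exists _ _ _ (fun S : {set 'I_n} => (#|S| < k)%N)) => S;
  exact: measurable_grow.
Qed.

(** Markov's inequality: a selection of fewer than k vertices has potential more
    than 2 ^- k, whereas after n vertices the mean potential is at most
    (1 - q / 2) ^+ n. *)
Lemma grow_small_prob :
  (P [set t | (#|H n t| < k)%N] <=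
   (expR (k%:R - n%:R * success_bound / 2))%:E)%E.
Proof.
have /andP[q0 q1] := success_bound_bounds.
apply: (@le_trans _ _ (\int[P]_t (2 ^+ k * potential (H n t))%:E)%E).
  apply: prob_le_integral.
  - exact: measurable_grow_small.
  - by apply: measurable_funM => //; exact: measurable_fun_grow.
  - by move=> t; rewrite mulr_ge0 ?exprn_ge0 ?potential_ge0.
  - move=> t /= small; rewrite /potential small.
    rewrite -(subnKC (ltnW small)) exprD mulrAC -exprMn mulfV ?pnatr_eq0//.
    by rewrite expr1n mul1r exprn_ege1// ler1n.
under eq_integral do rewrite EFinM.
rewrite ge0_integralZl_EFin ?exprn_ge0//; last 2 first.
- by move=> t _; rewrite lee_fin potential_ge0.
- by apply/measurable_EFinP; exact: measurable_fun_grow.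
apply: (le_trans (lee_wpmul2l _ (potential_decay (leqnn n)))).
  by rewrite lee_fin exprn_ge0.
rewrite -EFinM lee_fin expRD; apply: ler_pM; rewrite ?exprn_ge0//; first by lra.
- rewrite -[X in expR X]mulr1 expRM_natl; apply: lerXn2r; rewrite ?nnegrE ?expR_ge0//.
  exact: expR_ge1Dx.
- have -> : - (n%:R * success_bound / 2) = n%:R * (- (success_bound / 2)) by ring.
  rewrite expRM_natl; apply: lerXn2r; rewrite ?nnegrE ?expR_ge0//; first by lra.
  exact: expR_ge1Dx.
Qed.

End greedy_probability.

(** * The sparse maximum as a supremum; measurability *)

Section sparse_max_theory.
Context (R : realType) (n k : nat).
Implicit Types (A : 'I_n -> 'I_n -> R) (x : 'I_n -> R).

Definition qform A x : R := \sum_i \sum_j x i * A i j * x j.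

Lemma qformZ A x (c : R) : qform A (fun i => c * x i) = c ^+ 2 * qform A x.
Proof.
rewrite /qform mulr_sumr; apply: eq_bigr => i _; rewrite mulr_sumr.
by apply: eq_bigr => j _; ring.
Qed.

Lemma qform_mx A (x : 'cV[R]_n) :
  (x^T *m (\matrix_(i < n, j < n) A i j) *m x) 0 0 = qform A (fun i => x i 0).
Proof.
rewrite mxE /qform exchange_big/=; apply: eq_bigr => j _; rewrite mxE mulr_suml.
by apply: eq_bigr => i _; rewrite !mxE.
Qed.

Lemma sparse_maxE A : sparse_max k (\matrix_(i < n, j < n) A i j) =
  sup [set qform A x | x in [set x | (sparsity x <= k)%N /\ sqnorm x = 1]].
Proof.
congr sup; apply/seteqP; split => _ [x [xk x1] <-].
  exists (fun i => x i 0); last by rewrite qform_mx.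
  split => //; have sx0 : 0 <= sqnorm (fun i => x i 0) by exact: sqnorm_ge0.
  by rewrite -(sqr_sqrtr sx0) [X in X ^+ 2]x1 expr1n.
have xE : (fun i => (\col_i x i) i 0) = x by apply/funext => i; rewrite mxE.
exists (\col_i x i); last by rewrite qform_mx xE.
split; first by rewrite (_ : l0norm _ = sparsity x)// -{2}xE.
have -> : l2norm (\col_i x i) = Num.sqrt (sqnorm x).
  by congr Num.sqrt; apply: eq_bigr => i _; rewrite mxE.
by rewrite x1 sqrtr1.
Qed.

Lemma qform_bounded A : has_ubound
  [set qform A x | x in [set x | (sparsity x <= k)%N /\ sqnorm x = 1]].
Proof.
exists (\sum_i \sum_j `|A i j|) => _ [x [_ x1] <-].
apply: ler_sum => i _; apply: ler_sum => j _.
have x_le1 l : `|x l| <= 1.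
  by rewrite -ler_sqr ?nnegrE// expr1n real_normK ?num_real// -x1 coord_le_sqnorm.
apply: (le_trans (ler_norm _)); rewrite !normrM mulrAC.
by apply: ler_piMl => //; exact: mulr_ile1.
Qed.

Lemma qform_le_sparse_max A x : (sparsity x <= k)%N -> sqnorm x = 1 ->
  qform A x <= sparse_max k (\matrix_(i < n, j < n) A i j).
Proof.
by move=> xk x1; rewrite sparse_maxE; apply: (ub_le_sup (qform_bounded A)); exists x.
Qed.

Hypotheses (k0 : (0 < k)%N) (n0 : (0 < n)%N).

Lemma qform_nonempty A :
  [set qform A x | x in [set x | (sparsity x <= k)%N /\ sqnorm x = 1]] !=set0.
Proof.
pose x (i : 'I_n) : R := (i == Ordinal n0)%:R.
exists (qform A x); exists x => //; split.
  apply: leq_trans k0; rewrite -(card1 (Ordinal n0)); apply: subset_leq_card.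
  by apply/fintype.subsetP => i; rewrite !inE pnatr_eq0 eqb0 negbK.
rewrite /sqnorm (bigD1 (Ordinal n0))//= /x eqxx expr1n big1 ?addr0// => i /negbTE ->.
by rewrite expr0n.
Qed.

Lemma sparse_max_le A (c : R) :
  (forall x, (sparsity x <= k)%N -> sqnorm x = 1 -> qform A x <= c) ->
  sparse_max k (\matrix_(i < n, j < n) A i j) <= c.
Proof.
move=> H; rewrite sparse_maxE; apply: ge_sup; first exact: qform_nonempty.
by move=> _ [x [xk x1] <-]; exact: H.
Qed.

Lemma cvg_bigsum (I : Type) (s : seq I) (f : I -> nat -> R) (l : I -> R) :
  (forall i, f i N @[N --> \oo] --> l i) ->
  (\sum_(i <- s) f i N) @[N --> \oo] --> \sum_(i <- s) l i.
Proof.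
move=> fl; elim: s => [|i s IH].
  rewrite big_nil; under eq_fun do rewrite big_nil; exact: cvg_cst.
rewrite big_cons; under eq_fun do rewrite big_cons.
exact: cvgD (fl i) IH.
Qed.

Lemma cvg_floor_scaled (x : R) :
  ((Num.floor (x * N.+1%:R))%:~R / N.+1%:R : R) @[N --> \oo] --> x.
Proof.
have lower : (x - harmonic N : R) @[N --> \oo] --> x.
  by rewrite -[X in _ --> X]subr0; apply: cvgB; [exact: cvg_cst|exact: cvg_harmonic].
apply: (squeeze_cvgr _ lower (cvg_cst x)); apply: nearW => N.
have N0 : 0 < N.+1%:R :> R by rewrite ltr0n.
have /andP[lo hi] := floor_itv (x * N.+1%:R).
rewrite ler_pdivlMr// ler_pdivrMr// lo andbT /harmonic/= mulrBl mulVf ?lt0r_neq0//.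
by rewrite lerBlDr ltW// -[1]/(1%:~R) -intrD.
Qed.

(** The inequality qform A x > c * sqnorm x is open and homogeneous in x, so that a
    real solution can be scaled up and rounded coordinatewise to an integer one,
    without enlarging the support. Countably many conditions thus describe the
    supremum. *)
Lemma sparse_max_gtP A (c : R) :
  c < sparse_max k (\matrix_(i < n, j < n) A i j) <->
  exists z : {ffun 'I_n -> int}, (sparsity (fun i => (z i)%:~R : R) <= k)%N /\
    c * sqnorm (fun i => (z i)%:~R) < qform A (fun i => (z i)%:~R).
Proof.
split => [|[z [zk cz]]].
  rewrite sparse_maxE => /(sup_gt (qform_nonempty A))[_ [x [xk x1] <-] cx].
  pose w N i : R := (Num.floor (x i * N.+1%:R))%:~R / N.+1%:R.
  have wx i : w N i @[N --> \oo] --> x i by exact: cvg_floor_scaled.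
  have cvgh : (qform A (w N) - c * sqnorm (w N)) @[N --> \oo] -->
              qform A x - c * sqnorm x.
    apply: cvgB; first apply: cvg_bigsum => i.
      apply: cvg_bigsum => j; apply: cvgM; last exact: wx.
      by apply: cvgM; [exact: wx|exact: cvg_cst].
    apply: cvgM; first exact: cvg_cst.
    by apply: cvg_bigsum => i; rewrite expr2; apply: cvgM; exact: wx.
  have h0 : 0 < qform A x - c * sqnorm x by rewrite x1 mulr1 subr_gt0.
  have [N _ /(_ N (leqnn N))/=] := cvgr_gt _ cvgh _ h0.
  rewrite subr_gt0 => HN; exists [ffun i => Num.floor (x i * N.+1%:R)].
  have zE : (fun i => ([ffun i => Num.floor (x i * N.+1%:R)] i)%:~R) =
      (fun i => N.+1%:R * w N i).
    by apply/funext => i; rewrite ffunE /w [RHS]mulrC divfK// pnatr_eq0.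
  split.
    apply: leq_trans xk; apply: sparsity_le => i xi0.
    by rewrite ffunE xi0 mul0r floor0.
  by rewrite zE sqnormZ qformZ mulrCA ltr_pM2l// exprn_gt0.
have [s0|s0] := eqVneq (sqnorm (fun i => (z i)%:~R : R)) 0.
  move: cz; rewrite s0 mulr0 /qform big1 ?ltxx// => i _.
  by rewrite big1// => j _; rewrite (sqnorm_eq0 s0) !mul0r.
have spos : 0 < sqnorm (fun i => (z i)%:~R : R) by rewrite lt_def s0 sqnorm_ge0.
pose b := (Num.sqrt (sqnorm (fun i => (z i)%:~R : R)))^-1.
have b2 : b ^+ 2 = (sqnorm (fun i => (z i)%:~R : R))^-1.
  by rewrite exprVn sqr_sqrtr ?sqnorm_ge0.
have := @qform_le_sparse_max A (fun i => b * (z i)%:~R).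
rewrite sqnormZ qformZ b2 mulVf// => /(_ _ erefl) le_max.
apply: lt_le_trans (le_max _).
  by rewrite mulrC ltr_pdivlMr.
by apply: leq_trans zk; apply: sparsity_le => i ->; rewrite mulr0.
Qed.

Lemma measurable_sparse_max d (T : measurableType d) (B : 'I_n -> 'I_n -> T -> R) :
  (forall i j, measurable_fun setT (B i j)) ->
  measurable_fun setT (fun t => sparse_max k (\matrix_(i < n, j < n) B i j t)).
Proof.
move=> mB _; apply: (measurability _ (RGenOInfty.measurableE R)) => //.
move=> _ [_ [c ->] <-]; rewrite setTI.
pose E (z : {ffun 'I_n -> int}) : set T :=
  [set t | (sparsity (fun i => (z i)%:~R : R) <= k)%N /\
    c * sqnorm (fun i => (z i)%:~R) < qform (fun i j => B i j t) (fun i => (z i)%:~R)].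
have -> : (fun t => sparse_max k (\matrix_(i < n, j < n) B i j t)) @^-1` `]c, +oo[ =
    \bigcup_z E z.
  apply/seteqP; split => t /=; rewrite in_itv/= andbT.
    by move=> /(sparse_max_gtP (fun i j => B i j t) c)[z Hz]; exists z.
  by move=> [z _ Hz]; apply/(sparse_max_gtP (fun i j => B i j t) c); exists z.
apply: countable_bigcupT_measurable; first exact: countableP.
move=> z; rewrite /E; set s := sparsity _.
case: (boolP (s <= k)%N) => sk; last first.
  by rewrite (_ : [set t | _] = set0)//; apply/seteqP; split => // t [].
have mq : measurable_fun setT
    (fun t => qform (fun i j => B i j t) (fun i => (z i)%:~R)).
  apply: measurable_sum => i; apply: measurable_sum => j.
  by apply: measurable_funM => //; apply: measurable_funM.
rewrite (_ : [set t | _] =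
    (fun t => qform (fun i j => B i j t) (fun i => (z i)%:~R)) @^-1`
      `]c * sqnorm (fun i => (z i)%:~R), +oo[); last first.
  by apply/seteqP; split => t /=; rewrite in_itv/= andbT => // -[].
by rewrite -[X in measurable X]setTI; exact: mq.
Qed.

End sparse_max_theory.

(** * Bounds on the sparse maximum outside the exceptional events *)

Section deterministic_bounds.
Context (R : realType) (n k : nat).
Implicit Types (A : 'I_n -> 'I_n -> R).

(** Here w stands for sqrt (k log (n / k)), half of the normalization. *)
Lemma sparse_max_upper A (r : nat) (delta w : R) :
  (0 < k)%N -> (0 < n)%N -> (2 < r)%N -> 0 < w -> 0 < delta <= 8^-1 ->
  2 / r%:R <= delta ->
  (forall i j, A i j = A j i) ->
  (forall i, `|A i i| <= delta * w) ->
  (forall z : {ffun 'I_n -> code (r * k)}, in_net k r z ->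
     `|offdiag_form A (net_point R k r z)| <= 2 * (1 + delta) * w) ->
  sparse_max k (\matrix_(i < n, j < n) A i j) <= 2 * w * (1 + 8 * delta).
Proof.
move=> k0 n0 r2 w0 /andP[d0 d8] rd symA diagA netA.
apply: sparse_max_le => // x xk x1; rewrite /qform form_split//.
have off := offdiag_form_net_bound k0 r2 netA xk x1.
have diag : \sum_i A i i * x i ^+ 2 <= delta * w.
  rewrite -[leRHS]mulr1 -[X in _ <= _ * X]x1 /sqnorm mulr_sumr; apply: ler_sum => i _.
  by apply: ler_wpM2r; [exact: sqr_ge0|exact: le_trans (ler_norm _) (diagA i)].
have off' : offdiag_form A x <= 2 * (1 + delta) * w / (1 - delta).
  apply: (le_trans (ler_norm _)); apply: (le_trans off).
  apply: ler_wpM2l; first by rewrite !mulr_ge0//; lra.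
  by rewrite lef_pV2 ?posrE; lra.
apply: (le_trans (lerD diag off')).
rewrite -lerBrDl ler_pdivrMr; last lra.
have -> : (2 * w * (1 + 8 * delta) - delta * w) * (1 - delta) =
  w * ((2 + 15 * delta) * (1 - delta)) by ring.
have -> : 2 * (1 + delta) * w = w * (2 * (1 + delta)) by ring.
rewrite ler_pM2l//; nra.
Qed.

(** At the normalized vector of a complete greedy selection, the off-diagonal form is
    at least 2 tau / sqrt k times the sum of the gains, hence at least
    2 (1 - delta) sqrt L (sqrt k - 1). *)
Lemma sparse_max_lower A (delta L : R) :
  (0 < k)%N -> 0 < L -> 0 < delta <= 8^-1 -> delta^-1 <= Num.sqrt k%:R ->
  (forall i j, A i j = A j i) ->
  (forall i, `|A i i| <= delta * Num.sqrt (k%:R * L)) ->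
  #|grow k ((1 - delta) * Num.sqrt (2 * L)) A n| = k ->
  2 * Num.sqrt (k%:R * L) * (1 - 8 * delta) <= sparse_max k (\matrix_(i < n, j < n) A i j).
Proof.
move=> k0 L0 /andP[d0 d8] dk symA diagA.
set tau := (1 - delta) * _ => cardk.
have [_ _ Sn So] := grow_invariant k tau A n; rewrite cardk in Sn So.
set y := weight_vector R (grow k tau A n) in Sn So.
set sk := Num.sqrt k%:R in dk Sn.
have sk0 : 0 < sk by rewrite sqrtr_gt0 ltr0n.
pose b := (Num.sqrt sk)^-1.
have b2 : b ^+ 2 = sk^-1 by rewrite exprVn sqr_sqrtr// ltW.
pose x i := b * y i.
have xk : (sparsity x <= k)%N.
  rewrite -cardk; apply: subset_leq_card; apply/fintype.subsetP => i.
  by rewrite !inE /x /y /weight_vector; case: ifP => // _; rewrite mulr0 eqxx.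
have x1 : sqnorm x = 1 by rewrite sqnormZ b2 Sn mulVf// lt0r_neq0.
apply: le_trans (qform_le_sparse_max A xk x1).
rewrite /qform form_split// offdiag_formZ b2.
set w := Num.sqrt (k%:R * L) in diagA *.
have diag : - (delta * w) <= \sum_i A i i * x i ^+ 2.
  have -> : - (delta * w) = - (delta * w) * sqnorm x by rewrite x1 mulr1.
  rewrite /sqnorm mulr_sumr; apply: ler_sum => i _.
  apply: ler_wpM2r; first exact: sqr_ge0.
  by rewrite lerNl; apply: le_trans (diagA i); rewrite -normrN ler_norm.
have gains : Num.sqrt 2 / 2 * (k%:R - sk) <= \sum_(j < k) gain R j by exact: sum_gain_ge.
have sL0 : 0 < Num.sqrt L by rewrite sqrtr_gt0.
have tauE : tau * (Num.sqrt 2 / 2) = (1 - delta) * Num.sqrt L.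
  rewrite /tau sqrtrM//; set s := Num.sqrt 2.
  have -> : (1 - delta) * (s * Num.sqrt L) * (s / 2) =
      (1 - delta) * Num.sqrt L * (s ^+ 2 / 2) by ring.
  by rewrite sqr_sqrtr// mulfV// mulr1.
have tau0 : 0 <= tau by rewrite mulr_ge0 ?sqrtr_ge0//; lra.
have sk2 : sk ^+ 2 = k%:R by rewrite sqr_sqrtr.
have wE : w = sk * Num.sqrt L by rewrite /w sqrtrM.
have off : 2 * (1 - delta) * Num.sqrt L * (sk - 1) <= sk^-1 * offdiag_form A y.
  rewrite ler_pdivlMl//; apply: le_trans So.
  have -> : sk * (2 * (1 - delta) * Num.sqrt L * (sk - 1)) =
     2 * (tau * (Num.sqrt 2 / 2)) * (k%:R - sk) by rewrite tauE -sk2; ring.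
  have -> : 2 * (tau * (Num.sqrt 2 / 2)) * (k%:R - sk) =
     2 * tau * (Num.sqrt 2 / 2 * (k%:R - sk)) by ring.
  by apply: ler_wpM2l => //; rewrite mulr_ge0.
apply: le_trans (lerD diag off).
have sd : 1 <= delta * sk by rewrite mulrC -ler_pdivrMr// mul1r.
have sLw : Num.sqrt L <= delta * w by rewrite wE mulrA ler_peMl// ltW.
have w0 : 0 < w by rewrite wE mulr_gt0.
have -> : 2 * (1 - delta) * Num.sqrt L * (sk - 1) = 2 * (1 - delta) * (w - Num.sqrt L).
  by rewrite wE; ring.
nra.
Qed.

End deterministic_bounds.

(** * Deviation inequality *)

Section exponents.
Context (R : realType).
Implicit Types (k n L delta c : R).

(** With L = log (n / k), so that log n = log k + L, this is where k has to be large: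
    c k L must dominate log n. *)
Lemma diagonal_exponent c k L : 0 < c -> 2 / c <= k -> 4 / c <= L ->
  k + L - c * (k * L) <= - k.
Proof.
move=> c0; rewrite !ler_pdivrMr// => ck cL.
have L0 : 0 <= L by nra.
have k0 : 0 <= k by nra.
nra.
Qed.

(** Here C k + k L is the logarithm of the size of the net. *)
Lemma net_exponent delta C k L : 0 < delta -> 0 <= C -> 0 <= k ->
  (C + 1) / (2 * delta) <= L ->
  C * k + k * L - (1 + delta) ^+ 2 * (k * L) <= - k.
Proof.
move=> d0 C0 k0; rewrite ler_pdivrMr ?mulr_gt0// => CL.
have L0 : 0 <= L by nra.
have kL0 : 0 <= delta ^+ 2 * (k * L) by rewrite !mulr_ge0// ltW.
nra.
Qed.

(** The term (1 - delta) ^+ 2 * L leaves a positive fraction of L, of order delta * L,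
    against a defect of order sqrt L; hence the condition on L. *)
Lemma greedy_exponent delta L : 0 < delta <= 8^-1 -> 225 / delta ^+ 2 <= L ->
  3 <= L - (((1 - delta) * Num.sqrt (2 * L)) ^+ 2 / 2 +
            4 * ((1 - delta) * Num.sqrt (2 * L)) + 6).
Proof.
move=> /andP[d0 d8] hL.
have L0 : 0 <= L by apply: le_trans hL; rewrite divr_ge0// exprn_ge0// ltW.
have s2 : Num.sqrt L ^+ 2 = L by rewrite sqr_sqrtr.
have s0 := sqrtr_ge0 L.
have r2 : Num.sqrt 2 ^+ 2 = 2 :> R by rewrite sqr_sqrtr.
have r0 : 0 <= Num.sqrt 2 :> R by exact: sqrtr_ge0.
have r32 : Num.sqrt 2 <= 3 / 2 :> R.
  by rewrite -(@ler_sqr _ (Num.sqrt 2)) ?nnegrE// r2; lra.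
rewrite sqrtrM//; set s := Num.sqrt L in s2 s0 *; set q := Num.sqrt 2 in r2 r0 r32 *.
have ds : 15 <= delta * s.
  rewrite -(@ler_sqr _ 15) ?nnegrE ?mulr_ge0// ?(ltW d0)// exprMn s2 mulrC.
  rewrite -ler_pdivrMr ?exprn_gt0//; apply: le_trans hL.
  by rewrite ler_pM2r ?invr_gt0 ?exprn_gt0//; lra.
have -> : ((1 - delta) * (q * s)) ^+ 2 / 2 = (1 - delta) ^+ 2 * L.
  have -> : ((1 - delta) * (q * s)) ^+ 2 / 2 = (1 - delta) ^+ 2 * (q ^+ 2 / 2) * s ^+ 2 by ring.
  by rewrite r2 s2 mulfV// mulr1.
have qs : (1 - delta) * (q * s) <= 3 / 2 * s by nra.
have s15 : 15 <= s by nra.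
have dL : 15 * s <= delta * L by rewrite -s2 expr2 mulrA ler_wpM2r.
have dd : delta * L <= L - (1 - delta) ^+ 2 * L by nra.
lra.
Qed.

End exponents.

Section deviation_bound.
Context d (T : measurableType d) (R : realType) (P : probability T R).
Context (n k : nat) (alpha : R) (A : 'I_n -> 'I_n -> {RV P >-> R}).
Hypothesis hA : gaussian_symmetric alpha A.
Hypothesis alpha0 : 0 < alpha.

Lemma diagonal_large_prob (s : R) : 0 <= s ->
  (P [set t | exists2 i : 'I_n, xpredT i & (s <= `|A i i t|)%R] <=
   (2 * n%:R * expR (- (s ^+ 2 / (2 * alpha ^+ 2))))%:E)%E.
Proof.
move=> s0; have [_ _ hdiag _] := hA.
have a2 : 0 < alpha ^+ 2 by rewrite exprn_gt0.
apply: (le_trans (gaussian_union_bound (V := alpha ^+ 2) (l := s / alpha ^+ 2) s _ _ _)).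
- by [].
- move=> i _; exists (alpha ^+ 2) => // l.
  by rewrite (normal_law_mgf l (lt0r_neq0 alpha0) (hdiag i)).
- by rewrite divr_ge0// ltW.
rewrite lee_fin card_ord le_eqVlt; apply/orP; left; apply/eqP; congr (_ * expR _).
by field; exact: lt0r_neq0.
Qed.

Lemma measurable_offdiag (y : 'I_n -> R) :
  measurable_fun setT (fun t => offdiag_form (fun i j => A i j t) y).
Proof.
exact: (@measurable_linear_sum _ _ _ P _ (fun p => A p.1 p.2) (pairs n)
  (fun p => 2 * (y p.1 * y p.2))).
Qed.

Lemma offdiag_mgf (y : 'I_n -> R) :
  gaussian_mgf P (fun t => offdiag_form (fun i j => A i j t) y)
    (\sum_(p in pairs n) (2 * (y p.1 * y p.2)) ^+ 2).
Proof.
have [_ hoff _ hind] := hA.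
apply: (@linear_sum_mgf _ _ _ P _ (fun ij => A ij.1 ij.2) _ hind (pairs n)
  (fun p => 2 * (y p.1 * y p.2))).
- by apply/fintype.subsetP => p; rewrite !inE => /ltnW.
- by move=> p; rewrite inE; exact: hoff.
Qed.

Lemma net_large_prob (r : nat) (s : R) : (0 < k)%N -> (k <= n)%N -> (0 < r)%N -> 0 <= s ->
  (P [set t | exists2 z : {ffun 'I_n -> code (r * k)}, in_net k r z &
        (s <= `|offdiag_form (fun i j => A i j t) (net_point R k r z)|)%R] <=
   (2 * expR ((r ^ 2 * k)%:R + k%:R * ln (n%:R / k%:R) + 2 * k%:R - s ^+ 2 / 4))%:E)%E.
Proof.
move=> k0 kn r0 s0.
apply: (le_trans (@gaussian_union_bound _ _ _ P {ffun 'I_n -> code (r * k)}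
  [pred z | in_net k r z]
  (fun z t => offdiag_form (fun i j => A i j t) (net_point R k r z)) 2 (s / 2) s _ _ _)).
- by move=> z; exact: measurable_offdiag.
- move=> z zin; exists (\sum_(p in pairs n)
      (2 * (net_point R k r z p.1 * net_point R k r z p.2)) ^+ 2); last exact: offdiag_mgf.
  apply: (le_trans (offdiag_variance_le _)); rewrite ler_piMr// exprn_ile1 ?sqnorm_ge0//.
  exact: net_point_sqnorm.
- by rewrite divr_ge0.
rewrite lee_fin [in leRHS]expRD mulrA; apply: ler_pM; rewrite ?mulr_ge0 ?expR_ge0//.
  by rewrite ler_pM2l//; exact: card_net.
by rewrite ler_expR le_eqVlt; apply/orP; left; apply/eqP; field.
Qed.

End deviation_bound.

Section deviation_theorem.
Context (R : realType) (alpha : R).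
Hypothesis alpha0 : 0 < alpha.

(** The three exceptional events are a large diagonal entry, a large value of the
    form at a point of the net, and an incomplete greedy selection. *)
Lemma sparse_max_deviation (eps : R) : 0 < eps ->
  exists K L0 : R, forall n k d (T : measurableType d) (P : probability T R)
    (A : 'I_n -> 'I_n -> {RV P >-> R}),
  gaussian_symmetric alpha A -> (0 < k)%N -> (k < n)%N -> K <= k%:R ->
  L0 <= ln (n%:R / k%:R) ->
  (P [set t | (eps < `|sparse_max k (\matrix_(i < n, j < n) A i j t) /
       (2 * Num.sqrt (k%:R * ln (n%:R / k%:R))) - 1|)%R] <= (5 * expR (- k%:R))%:E)%E.
Proof.
move=> eps0; pose delta : R := Num.min eps 1 / 8.
have dd : 0 < delta <= 8^-1.
  have m0 : 0 < Num.min eps 1 by rewrite lt_min eps0 ltr01.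
  have m1 : Num.min eps 1 <= 1 by rewrite ge_min lexx orbT.
  by rewrite /delta divr_gt0//= ler_pdivrMr// mulVf.
have d_eps : 8 * delta <= eps by rewrite /delta mulrC divfK// ge_min lexx.
(* From here on delta is only known by these inequalities. *)
have /andP[d0 d8] := dd; move: delta dd d_eps d0 d8 => delta dd d_eps d0 d8.
pose r := (Num.truncn (2 / delta)).+3.
have r2 : (2 < r)%N by [].
have r0 : (0 < r)%N by [].
have rd : 2 / r%:R <= delta.
  rewrite ler_pdivrMr ?ltr0n// mulrC -ler_pdivrMr//.
  apply: le_trans (ltW (truncnS_gt _)) _; by rewrite ler_nat ltnS; exact/leqW/leqW.
pose c : R := delta ^+ 2 / (2 * alpha ^+ 2).
have c0 : 0 < c by rewrite divr_gt0 ?mulr_gt0 ?exprn_gt0.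
pose C : R := (r ^ 2)%:R + 2.
exists (Num.max (2 / c) (delta^-1 ^+ 2)).
exists (Num.max (4 / c) (Num.max ((C + 1) / (2 * delta)) (225 / delta ^+ 2))).
move=> n k d T P A hA k0 kn; rewrite !ge_max => /andP[K1 K2] /and3P[L1 L2 L3].
set L := ln _ in L1 L2 L3 *.
have kR : 0 < k%:R :> R by rewrite ltr0n.
have n0 : (0 < n)%N by exact: ltn_trans kn.
have nR : 0 < n%:R :> R by rewrite ltr0n.
have L0 : 0 < L by apply: lt_le_trans L1; rewrite divr_gt0.
have nE : n%:R = k%:R * expR L :> R.
  by rewrite lnK ?posrE ?divr_gt0// mulrC divfK// lt0r_neq0.
set w := Num.sqrt (k%:R * L).
have w2 : w ^+ 2 = k%:R * L by rewrite sqr_sqrtr// mulr_ge0// ltW.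
have w0 : 0 < w by rewrite sqrtr_gt0 mulr_gt0.
have [hsym hoff hdiag hind] := hA.
pose a t i j := A i j t.
pose tau := (1 - delta) * Num.sqrt (2 * L).
have tau0 : 0 <= tau by rewrite mulr_ge0 ?sqrtr_ge0//; lra.
pose E1 := [set t | exists2 i : 'I_n, xpredT i & delta * w <= `|A i i t|].
pose E2 := [set t | exists2 z : {ffun 'I_n -> code (r * k)}, in_net k r z &
  2 * (1 + delta) * w <= `|offdiag_form (a t) (net_point R k r z)|].
pose E3 := [set t | (#|grow k tau (a t) n| < k)%N].
have mE1 : measurable E1.
  apply: (@measurable_exists _ _ _ xpredT (fun i => [set t | delta * w <= `|A i i t|])) => i.
  exact: measurable_abs_ge.
have mE2 : measurable E2.
  apply: (@measurable_exists _ _ _ (in_net k r) (fun z => [set t |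
    2 * (1 + delta) * w <= `|offdiag_form (a t) (net_point R k r z)|])) => z.
  by apply: measurable_abs_ge; exact: measurable_offdiag.
have mE3 : measurable E3 by exact: measurable_grow_small.
have P1 : (P E1 <= (2 * expR (- k%:R))%:E)%E.
  apply: (le_trans (diagonal_large_prob hA alpha0 (mulr_ge0 (ltW d0) (ltW w0)))).
  rewrite lee_fin -mulrA ler_pM2l// nE exprMn w2.
  apply: (@le_trans _ _ (expR (k%:R + L - c * (k%:R * L)))).
    rewrite !expRD -!mulrA; apply: ler_pM; rewrite ?mulr_ge0 ?expR_ge0//.
      by apply: le_trans (expR_ge1Dx _); rewrite lerDr.
    rewrite ler_pM2l ?expR_gt0// ler_expR lerN2 /c le_eqVlt; apply/orP; left.
    by apply/eqP; field; exact: lt0r_neq0.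
  by rewrite ler_expR; exact: diagonal_exponent.
have P2 : (P E2 <= (2 * expR (- k%:R))%:E)%E.
  have s0 : 0 <= 2 * (1 + delta) * w by rewrite !mulr_ge0// ?(ltW w0)//; lra.
  apply: (le_trans (net_large_prob hA k0 (ltnW kn) r0 s0)).
  rewrite lee_fin ler_pM2l// ler_expR -/L.
  have C0 : 0 <= C by rewrite addr_ge0.
  apply: le_trans (net_exponent d0 C0 (ltW kR) L2).
  rewrite le_eqVlt; apply/orP; left; apply/eqP.
  by rewrite !exprMn w2 natrM /C; field.
have P3 : (P E3 <= (expR (- k%:R))%:E)%E.
  apply: (le_trans (grow_small_prob k tau0 hind hoff)).
  rewrite lee_fin ler_expR.
  have exponent := greedy_exponent dd L3.
  (* As 8 <= expR 3, this is the inequality 4 * k <= n * success_bound. *)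
  have e8 : 8 <= expR L * expR (- (tau ^+ 2 / 2 + 4 * tau + 6)).
    rewrite -expRD; apply: (@le_trans _ _ (expR 3)); last by rewrite ler_expR.
    have -> : 3 = 2 + 1 :> R by ring.
    rewrite expRD; have := expR2_ge4 R; have := expR_ge1Dx (1 : R); nra.
  have : 8 * k%:R <= n%:R * expR (- (tau ^+ 2 / 2 + 4 * tau + 6)).
    by rewrite nE -mulrA mulrC ler_pM2l.
  rewrite /success_bound; lra.
have mM : measurable_fun setT (fun t => sparse_max k (\matrix_(i < n, j < n) A i j t)).
  exact: measurable_sparse_max.
have sub : [set t | eps < `|sparse_max k (\matrix_(i < n, j < n) A i j t) /
    (2 * w) - 1|] `<=` E1 `|` E2 `|` E3.
  move=> t /= big; apply: contrapT => /not_orP[/not_orP[nE1 nE2] nE3].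
  have diagA i : `|a t i i| <= delta * w.
    by rewrite leNgt; apply/negP => h; apply: nE1; exists i => //; exact: ltW.
  have netA (z : {ffun 'I_n -> code (r * k)}) : in_net k r z ->
      `|offdiag_form (a t) (net_point R k r z)| <= 2 * (1 + delta) * w.
    by move=> zin; rewrite leNgt; apply/negP => h; apply: nE2; exists z => //; exact: ltW.
  have symA i j : a t i j = a t j i by exact: hsym.
  have upper := sparse_max_upper k0 n0 r2 w0 dd rd symA diagA netA.
  have cardk : #|grow k tau (a t) n| = k.
    have [_ ck _ _] := grow_invariant k tau (a t) n.
    by apply/eqP; rewrite eqn_leq ck leqNgt; apply/negP.
  have dk : delta^-1 <= Num.sqrt k%:R.
    by rewrite -(@ler_sqr _ delta^-1) ?nnegrE ?sqrtr_ge0 ?invr_ge0 ?(ltW d0)// sqr_sqrtr.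
  have lower := sparse_max_lower k0 L0 dd dk symA diagA cardk.
  move: (le_lt_trans d_eps big); rewrite ltNge => /negP; apply.
  have w20 : 0 < 2 * w by rewrite mulr_gt0.
  rewrite ler_norml lerBlDl lerBrDl ler_pdivlMr// ler_pdivrMr//.
  by apply/andP; split; rewrite mulrC.
have mbad : measurable [set t | eps < `|sparse_max k (\matrix_(i < n, j < n) A i j t) /
    (2 * w) - 1|].
  have mf : measurable_fun setT (fun t =>
      `|sparse_max k (\matrix_(i < n, j < n) A i j t) / (2 * w) - 1|).
    apply: measurableT_comp => //; apply: measurable_funB => //.
    exact: measurable_funM.
  rewrite (_ : [set t | _] = (fun t =>
      `|sparse_max k (\matrix_(i < n, j < n) A i j t) / (2 * w) - 1|) @^-1`
      `]eps, +oo[); last first.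
    by apply/seteqP; split => t /=; rewrite in_itv/= andbT.
  by rewrite -[X in measurable X]setTI; exact: mf.
apply: (@le_trans _ _ (P (E1 `|` E2 `|` E3))).
  apply: le_measure; rewrite ?inE//; apply: measurableU => //; exact: measurableU.
have U12 : (P (E1 `|` E2) <= P E1 + P E2)%E by exact: measureU2.
have U123 : (P (E1 `|` E2 `|` E3) <= P (E1 `|` E2) + P E3)%E.
  by apply: measureU2 => //; exact: measurableU.
apply: (le_trans U123).
have -> : 5 * expR (- k%:R) = 2 * expR (- k%:R) + 2 * expR (- k%:R) + expR (- k%:R) :> R.
  by ring.
rewrite !EFinD; apply: leeD => //.
by apply: (le_trans U12); exact: leeD.
Qed.

End deviation_theorem.

(** * Convergence in probability *)

Unset Implicit Arguments.

Theorem theorem4 (R : realType) (alpha : R) (halpha : 0 < alpha)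
    (k : nat -> nat) (hk : forall n, (0 < k n)%N)
    (hk_oo : k n @[n --> \oo] --> \oo)
    (hkn : ((k n)%:R / n%:R : R) @[n --> \oo] --> (0 : R))
    (d : nat -> measure_display) (T : forall n, measurableType (d n))
    (P : forall n, probability (T n) R)
    (A : forall n, 'I_n -> 'I_n -> {RV (P n) >-> R})
    (hA : forall n, gaussian_symmetric alpha (A n)) :
  cvg_in_probability P
    (fun n t =>
       sparse_max (k n) (\matrix_(i < n, j < n) A n i j t) /
       (2 * Num.sqrt ((k n)%:R * ln (n%:R / (k n)%:R))))
    1.
Proof.
move=> eps eps0.
have [K [L0 dev]] := sparse_max_deviation halpha eps0.
have vanish : (5 * (harmonic (k n) : R))%:E @[n --> \oo] --> 0%E.
  apply/fine_cvgP; split; first exact: nearW.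
  rewrite -[X in _ --> X](mulr0 5); apply: cvgM; first exact: cvg_cst.
  exact: cvg_comp hk_oo cvg_harmonic.
apply: (squeeze_cvge _ (cvg_cst 0%E) vanish).
have kK : \forall n \near \oo, K <= (k n)%:R.
  have := hk_oo _ (nbhs_infty_gt (Num.truncn K)); rewrite /= => H.
  near=> n; apply: ltW; apply: lt_le_trans (truncnS_gt K) _; rewrite ler_nat.
  by near: n.
have small (c : R) : 0 < c -> \forall n \near \oo, (k n)%:R / n%:R < c.
  by move=> c0; exact: cvgr_lt hkn _ c0.
near=> n.
have n0 : (0 < n)%N by near: n; exact: nbhs_infty_gt.
have nR : 0 < n%:R :> R by rewrite ltr0n.
have kR : 0 < (k n)%:R :> R by rewrite ltr0n.
have kn : (k n < n)%N.
  rewrite -(ltr_nat R) -[ltRHS]mul1r -ltr_pdivrMr//; near: n; exact: small.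
have Ln : L0 <= ln (n%:R / (k n)%:R).
  rewrite -(expRK L0) ler_ln ?posrE ?expR_gt0 ?divr_gt0//.
  rewrite -[leLHS]invrK -invf_div lef_pV2 ?posrE ?invr_gt0 ?expR_gt0 ?divr_gt0//.
  apply: ltW; near: n; apply: small; by rewrite invr_gt0 expR_gt0.
have Kn : K <= (k n)%:R by near: n.
rewrite measure_ge0/=.
apply: (le_trans (dev n (k n) (d n) (T n) (P n) (A n) (hA n) (hk n) kn Kn Ln)).
rewrite lee_fin ler_pM2l// expRN /harmonic/= lef_pV2 ?posrE ?expR_gt0 ?ltr0n//.
by rewrite -natr1 addrC expR_ge1Dx.
Unshelve. all: end_near.
Qed.
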